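(* Let $Y$ be a subset of $\mathrm{GL}(n,q)$ and suppose that $Y$ is $(\sigma,\tau)$-transitive for some $(\sigma,\tau)\in\Theta_{n,q}$. Then $Y$ is also $(\hat\sigma,\hat\tau)$-transitive for all $(\hat\sigma,\hat\tau)\in\Theta_{n,q}$ satisfying $(\sigma,\tau)\preceq(\hat\sigma,\hat\tau)$.
   Context: Throughout $n\ge1$ and $q$ is a prime power. Partitions. A partition $\lambda=(\lambda_1\ge\lambda_2\ge\cdots)$ is a nonincreasing sequence of nonnegative integers with finite sum $|\lambda|$; nonzero entries are its parts, $\varnothing$ is the partition of $0$. For partitions $\lambda,\mu$ (possibly of different sizes): $\mu\unlhd\lambda$ means $\sum_{i\le k}\mu_i\le\sum_{i\le k}\lambda_i$ for all $k\ge1$; $\mu$ refines $\lambda$ if $|\mu|\le|\lambda|$ and the parts of $\lambda$ can be partitioned to produce the parts of $(\mu_1,\mu_2,\dots,1^{|\lambda|-|\mu|})$. On pairs of partitions, $(\nu,\mu)\preceq(\kappa,\lambda)$ iff $\kappa$ refines $\nu$ and $\mu\unlhd\lambda$. Flags. A composition of $n$ is a finite sequence of positive integers with sum $n$. $\Sigma_{n,q}$ is the set of pairs $(\rho,\mathcal I)$ with $\rho=(\rho_1,\dots,\rho_\ell)$ a composition of $n$ and $\mathcal I\subseteq\{1,\dots,\ell\}$, where for $q=2$ it is required that $\rho_i>1$ for all $i\notin\mathcal I$. For $\alpha=(\rho,\mathcal I)$, an $\alpha$-flag is a pair $(F,B)$ where $F=(V_1,\dots,V_\ell)$ is a sequence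 of subspaces $\{0\}=V_0\le V_1\le\cdots\le V_\ell=\mathbb{F}_q^n$ with $\dim(V_i/V_{i-1})=\rho_i$, and $B$ is a tuple containing one ordered basis of $V_i/V_{i-1}$ for each $i\in\mathcal I$. $\mathrm{GL}(n,q)$ acts naturally on $\alpha$-flags. $\operatorname{type}(\alpha)=(\sigma,\tau)$, where $\sigma$ is the partition with parts $\rho_i$, $i\in\mathcal I$, and $\tau$ the partition with parts $\rho_i$, $i\notin\mathcal I$. $\Theta_{n,q}$ is the set of all types of elements of $\Sigma_{n,q}$, i.e. all pairs of partitions $(\sigma,\tau)$ with $|\sigma|+|\tau|=n$ and, if $q=2$, all parts of $\tau$ larger than $1$. A subset $Y\subseteq\mathrm{GL}(n,q)$ is transitive on a set $\Omega$ with $\mathrm{GL}(n,q)$-action if there is a constant $r$ such that for all $a,b\in\Omega$ exactly $r$ elements $g\in Y$ satisfy $ga=b$. For $(\sigma,\tau)\in\Theta_{n,q}$, $Y$ is $(\sigma,\tau)$-transitive if $Y$ is transitive on the set of $\alpha$-flags for some $\alpha\in\Sigma_{n,q}$ of type $(\sigma,\tau)$. *)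

(* Defs.v *)
From HB Require Import structures.
From mathcomp Require Import all_boot all_order all_fingroup all_algebra.

Set Implicit Arguments.
Unset Strict Implicit.
Unset Printing Implicit Defensive.

Import GRing.Theory.
Local Open Scope nat_scope.

(* A partition is encoded by the finite list of its (nonzero) parts, in
   nonincreasing order; the i-th entry of the padded infinite sequence is
   [nth 0 l i.-1] and its size is [sumn l]. *)
Definition is_partition (l : seq nat) : bool := sorted geq l && (0 \notin l).

Definition dominated (mu lambda : seq nat) : Prop :=
  forall k, 1 <= k ->
    \sum_(i < k) nth 0 mu i <= \sum_(i < k) nth 0 lambda i.

(* [blocks] lists, for each part of lambda, the pieces this part is cut into. *)
Definition refines (mu lambda : seq nat) : Prop :=
  sumn mu <= sumn lambda /\
  exists2 blocks : seq (seq nat),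
    [seq sumn b | b <- blocks] = lambda &
    perm_eq (flatten blocks) (mu ++ nseq (sumn lambda - sumn mu) 1).

Definition pair_le (numu kappalambda : seq nat * seq nat) : Prop :=
  refines kappalambda.1 numu.1 /\ dominated numu.2 kappalambda.2.

(* Indices are 0-based: the element i of 'I_(size rho) stands for i + 1. *)
Record flag_shape := FlagShape {
  dims : seq nat;
  marked : {set 'I_(size dims)}
}.

Definition is_composition (n : nat) (rho : seq nat) : bool :=
  (0 \notin rho) && (sumn rho == n).

Definition in_Sigma (n q : nat) (alpha : flag_shape) : Prop :=
  is_composition n (dims alpha) /\
  (q = 2 -> forall i, i \notin marked alpha -> 1 < nth 0 (dims alpha) i).

Definition shape_type (alpha : flag_shape) : seq nat * seq nat :=
  (sort geq [seq nth 0 (dims alpha) i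
            | i : 'I_(size (dims alpha)) in marked alpha],
   sort geq [seq nth 0 (dims alpha) i
            | i : 'I_(size (dims alpha)) in ~: marked alpha]).

Definition in_Theta (n q : nat) (st : seq nat * seq nat) : Prop :=
  exists2 alpha, in_Sigma n q alpha & shape_type alpha = st.

Lemma in_Theta_partition n q st :
  in_Theta n q st -> is_partition st.1 && is_partition st.2.
Proof.
have geq_total : total geq by move=> x y; exact: leq_total.
case=> alpha [/andP[rho_gt0 _] _] <-; rewrite /is_partition /=.
rewrite !sort_sorted //= !mem_sort.
by apply/andP; split; apply: contra rho_gt0 => /imageP[i _ ->]; exact: mem_nth.
Qed.

(* The library's {'GL_n[F]} consists of matrices of size n.-1.+1, which is n
   when n >= 1.  It acts on column vectors from the left. *)
Notation vecs F n := 'cV[F]_n.-1.+1.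

Section Flags.

Variables (F : finFieldType) (n : nat).
Implicit Types (U W : {vspace vecs F n}) (g : {'GL_n[F]}).

Definition vcoset U (v : vecs F n) : {set vecs F n} :=
  [set x | (x - v)%R \in U].

(* An element of W / U is represented by the coset it is; the [vs] are
   representatives of the members of the tuple [cs] of cosets. *)
Definition quotient_basis U W (cs : seq {set vecs F n}) : Prop :=
  exists vs : seq (vecs F n),
    [/\ cs = [seq vcoset U v | v <- vs],
        {subset vs <= W},
        (forall k : 'I_(size vs) -> F,
           (\sum_(j < size vs) k j *: vs`_j)%R \in U -> forall j, k j = 0%R) &
        (forall w, w \in W -> exists k : 'I_(size vs) -> F,
           (w - \sum_(j < size vs) k j *: vs`_j)%R \in U)].

Definition flag_data (alpha : flag_shape) : Type :=
  ((size (dims alpha)).-tuple {vspace vecs F n} *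
   {ffun {i : 'I_(size (dims alpha)) | i \in marked alpha} ->
      seq {set vecs F n}})%type.

Definition flag_space alpha (a : flag_data alpha) (i : nat) :
  {vspace vecs F n} := nth 0%VS (0%VS :: a.1) i.

Definition is_flag alpha (a : flag_data alpha) : Prop :=
  [/\ forall i : 'I_(size (dims alpha)),
        (flag_space a i <= flag_space a i.+1)%VS /\
        \dim (flag_space a i.+1) = \dim (flag_space a i) + nth 0 (dims alpha) i,
      flag_space a (size (dims alpha)) = fullv &
      forall i : {i | i \in marked alpha},
        quotient_basis (flag_space a (val i)) (flag_space a (val i).+1)
          (a.2 i)].

Definition act_space g U : {vspace vecs F n} :=
  (linfun (mulmx (GLval g)) @: U)%VS.

Definition act_coset g (C : {set vecs F n}) : {set vecs F n} :=
  [set (GLval g *m x)%R | x in C].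

Definition act_flag alpha g (a : flag_data alpha) : flag_data alpha :=
  (map_tuple (act_space g) a.1, [ffun i => map (act_coset g) (a.2 i)]).

End Flags.

Definition transitive_on (gT : finType) (T : eqType) (act : gT -> T -> T)
    (Y : {set gT}) (Omega : T -> Prop) : Prop :=
  exists r : nat, forall a b : T, Omega a -> Omega b ->
    #|[set g in Y | act g a == b]| = r.

Definition type_transitive (F : finFieldType) (n : nat) (Y : {set {'GL_n[F]}})
    (st : seq nat * seq nat) : Prop :=
  exists alpha : flag_shape,
    [/\ in_Sigma n #|F| alpha, shape_type alpha = st &
        transitive_on (@act_flag F n alpha) Y (@is_flag F n alpha)].

(* Main.v *)
From HB Require Import structures.
From mathcomp Require Import all_boot all_order all_fingroup all_algebra.
From mathcomp Require Import mxabelem zify.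
Require Import Defs.

Set Implicit Arguments.
Unset Strict Implicit.
Unset Printing Implicit Defensive.
Import Order.TTheory GRing.Theory Num.Theory.
Local Open Scope ring_scope.

(* A set Y is transitive on G / H if and only if f = |G| 1_Y - |Y| sums to zero
   over every translate y H z.  For the stabilizers H of two flags that differ
   only between V_i and V_j, this vanishing passes from one to the other as
   soon as it does so for functions on the diagonal block of V_j / V_i, and
   three moves of this kind suffice.
   - A marked block has the trivial group, so it may be replaced by anything:
     it may be refined, and its basis may be forgotten.
   - A marked block of size a followed by an unmarked one may be exchanged with
     it.  Vanishing of the sums over {g | g f0 = f1} for all m x a matrices
     f0, f1 gives that of the sums over {g | p1 g = p0} by Fourier inversion;
     summed over a line of characters, a nontrivial character of F becomes the
     rational function x |-> q [x = 0] - 1.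
   - Unmarked blocks (x, y) may be replaced by (k, x + y - k) for every
     k <= min(x, y), which is Kantor's injectivity of the incidence map between
     k-spaces and x-spaces.  The sums over {g | p g f = 0} vanish for matrices
     p, f of ranks y, x, hence of smaller ranks, and Fourier inversion over all
     k x m matrices p isolates {g | g K0 = K1} for K0, K1 of dimension k.
   The first move turns sigma into sigma' and ones, the second collects the
   unmarked blocks in front, and the third sorts them increasingly and then
   moves single units upwards until tau' is reached. *)

(** * Fourier inversion on spaces of matrices over a finite field *)

Section MatrixCounting.
Variable F : finFieldType.
Local Notation q := (#|F|%:R : rat).

Lemma natr_card_F_neq1 : q - 1 != 0.
Proof.
rewrite subr_eq0 pnatr_eq1 neq_ltn; apply/orP; right.
exact: card_finNzRing_gt1.
Qed.

(** Orthogonality of characters: the linear form [\tr (p *m T)] on the space of [p] with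
    [p *m A = 0] either vanishes identically, which means [kermx A *m T = 0], or takes every value
    equally often, and then the weights cancel. *)
Lemma sum_trace_zero k n r (A : 'M[F]_(n, r)) (T : 'M[F]_(n, k)) :
  \sum_(p : 'M[F]_(k, n) | p *m A == 0) (q * (\tr (p *m T) == 0)%:R - 1) =
  if kermx A *m T == 0
  then (q - 1) * #|[pred p : 'M[F]_(k, n) | p *m A == 0]|%:R else 0.
Proof.
case: ifPn => [/eqP KT0 | KT0].
  rewrite (eq_bigr (fun=> q - 1)) => [|p].
    by rewrite mulr_natr -[RHS]sumr_const; apply: eq_bigl => p; rewrite inE.
  move=> /eqP/sub_kermxP/submxP[c ->].
  by rewrite -mulmxA KT0 mulmx0 mxtrace0 eqxx mulr1.
(* If entry [(i, j)] of [kermx A *m T] is nonzero, row [i] of the kernel placed in row [j] and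
   rescaled has trace 1 against [T]. *)
have [p0 p0A trp0]: exists2 p0 : 'M[F]_(k, n), p0 *m A = 0 & \tr (p0 *m T) = 1.
  move: (kermx A) KT0 (mulmx_ker A) => K /matrix0Pn[i [j KTij]] KA.
  exists (((K *m T) i j)^-1 *: (delta_mx j i *m K)).
    by rewrite -scalemxAl -mulmxA KA mulmx0 scaler0.
  rewrite -scalemxAl -mulmxA mxtraceZ; move: (K *m T) KTij => B Bij.
  rewrite /mxtrace (bigD1 j) //= big1 => [|l /negPf lj].
    rewrite addr0 mxE (bigD1 i) //= big1 => [|l /negPf li].
      by rewrite addr0 mxE !eqxx mul1r mulVf.
    by rewrite mxE li andbF mul0r.
  by rewrite mxE big1 // => h _; rewrite mxE lj mul0r.
rewrite big_split /= -mulr_sumr.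
(* [S c] counts the [p] of trace [c]; translation by [c *: p0] shows that it does not depend on
   [c]. *)
pose S c := \sum_(p : 'M[F]_(k, n) | p *m A == 0) (\tr (p *m T) == c)%:R : rat.
have S_eq c : S c = S 0.
  rewrite /S (reindex_inj (addrI (c *: p0))) /=; apply: eq_big => [p | p _].
    by rewrite mulmxDl -scalemxAl p0A scaler0 add0r.
  by rewrite mulmxDl -scalemxAl mxtraceD mxtraceZ trp0 mulr1 -subr_eq0 addrC addKr.
have -> : q * S 0 = \sum_(c : F) S c.
  by under eq_bigr do rewrite S_eq; rewrite sumr_const mulr_natl.
rewrite exchange_big -big_split big1 //= => p _.
rewrite (bigD1 (\tr (p *m T))) //= eqxx big1 ?addr0 ?subrr // => c.
by rewrite eq_sym => /negPf->.
Qed.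

Lemma sum_unit_translate m (f : 'M[F]_m -> rat) (P : pred 'M[F]_m) (y z : 'M[F]_m) :
  y \in unitmx -> z \in unitmx ->
  \sum_(h in unitmx | P h) f (y *m h *m z) =
  \sum_(g in unitmx | P (invmx y *m g *m invmx z)) f g.
Proof.
move=> uy uz; rewrite [RHS](reindex (fun h => y *m h *m z)) /=.
  apply: eq_bigl => h; rewrite !unitmx_mul uy uz andbT /=; congr (_ && _).
  by rewrite -(mulmxA y) mulKmx // mulmxK.
exists (fun g => invmx y *m g *m invmx z) => h _.
  by rewrite -(mulmxA y) mulKmx // mulmxK.
by rewrite -(mulmxA (invmx _)) mulKVmx // mulmxKV.
Qed.

Section Swap.
Variables (m a : nat) (phi : 'M[F]_m -> rat).
Hypothesis phi0 : forall y z : 'M[F]_m, y \in unitmx -> z \in unitmx ->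
  \sum_(h in unitmx | h *m pid_mx a == pid_mx a :> 'M_(m, a)) phi (y *m h *m z) = 0.

(** Write [f0 = L *m pid_mx a *m E] and split by the value of [g *m (L *m pid_mx a)]. Each fibre is
    empty or, given a member [g0], the translate of the fixer of [pid_mx a] by [g0 *m L] and
    [invmx L]. The factor [E] absorbs the rank deficiency of [f0]. *)
Lemma sum_image_eq0 (f0 f1 : 'M[F]_(m, a)) :
  \sum_(g in unitmx | g *m f0 == f1) phi g = 0.
Proof.
set L := col_ebase f0; set E : 'M_a := pid_mx (\rank f0) *m row_ebase f0.
have f0E : f0 = L *m pid_mx a *m E.
  rewrite /E mulmxA -(mulmxA L) mul_pid_mx !(minn_idPr (rank_leq_col _)).
  by rewrite mulmx_ebase.
have uL : L \in unitmx by exact: col_ebase_unit.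
have ph1 (f : 'M[F]_(m, a)) : \sum_(g in unitmx | g *m (L *m pid_mx a) == f) phi g = 0.
  case: (pickP [pred g | (g \in unitmx) && (g *m (L *m pid_mx a) == f)]).
    move=> g0 /= /andP[ug0 /eqP g0f].
    have ugL : g0 *m L \in unitmx by rewrite unitmx_mul ug0.
    have uL' : invmx L \in unitmx by rewrite unitmx_inv.
    rewrite -[RHS](phi0 ugL uL').
    rewrite sum_unit_translate // invmxK; apply: eq_bigl => g; congr (_ && _).
    rewrite -g0f -[RHS](can_eq (mulKmx ugL)) !mulmxA.
    by rewrite mulmxV // mul1mx.
  by move=> no; rewrite big_pred0.
rewrite (partition_big (fun g => g *m (L *m pid_mx a)) (fun f => f *m E == f1)) /=.
  rewrite big1 // => f /eqP fE; rewrite -[RHS](ph1 f); apply: eq_bigl => g.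
  rewrite -andbA; congr (_ && _); rewrite andbC; case: eqP => //= gf.
  by rewrite f0E mulmxA gf fE eqxx.
by move=> g /andP[_ /eqP <-]; rewrite -mulmxA -f0E.
Qed.

(** The condition is detected by weights summed over test matrices [f]. The trace of
    [f *m (p1 *m g - p0)] depends on [g] only through [g *m f], so [sum_image_eq0] applies on each
    fibre of [g *m f]. *)
Lemma sum_coimage_eq0 (p0 p1 : 'M[F]_(a, m)) :
  \sum_(g in unitmx | p1 *m g == p0) phi g = 0.
Proof.
pose w (p : 'M[F]_(a, m)) := \sum_(f : 'M[F]_(m, a)) (q * (\tr (f *m p) == 0)%:R - 1).
pose c : rat := (q - 1) * #|[pred p : 'M[F]_(m, a) | p *m (0 : 'M[F]_a) == 0]|%:R.
have w0 p : w p = if p == 0 then c else 0.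
  have := sum_trace_zero (0 : 'M[F]_a) p.
  rewrite -sub_kermx kermx0 sub_kermx mul1mx => <-; apply: eq_bigl => f; by rewrite mulmx0 eqxx.
have c0 : c != 0.
  rewrite mulf_neq0 ?natr_card_F_neq1 // pnatr_eq0 -lt0n; apply/card_gt0P.
  by exists 0; rewrite inE mul0mx.
apply: (mulfI c0); rewrite mulr0.
transitivity (\sum_(g in unitmx) phi g * w (p1 *m g - p0)).
  rewrite mulr_sumr big_mkcondr; apply: eq_bigr => g _.
  by rewrite w0 subr_eq0 mulrC; case: eqP; rewrite ?mulr0.
under eq_bigr do rewrite mulr_sumr; rewrite exchange_big big1 //= => f _.
rewrite (partition_big (fun g => g *m f) xpredT) //= big1 // => f1 _.
under eq_bigr => g /andP[_ /eqP gf].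
  rewrite mxtrace_mulC mulmxBl -mulmxA gf; over.
by rewrite -mulr_suml sum_image_eq0 mul0r.
Qed.

End Swap.

Lemma eqrank_unitmx m (A B : 'M[F]_m) : \rank A = \rank B ->
  exists y, exists z, [/\ y \in unitmx, z \in unitmx & B = y *m A *m z].
Proof.
move=> rAB; exists (col_ebase B *m invmx (col_ebase A)).
exists (invmx (row_ebase A) *m row_ebase B).
rewrite !unitmx_mul !unitmx_inv !col_ebase_unit !row_ebase_unit; split=> //.
have := mulmx_ebase A; rewrite rAB.
have := col_ebase_unit A; have := row_ebase_unit A.
move: (col_ebase A) (row_ebase A) => L R uR uL <-.
by rewrite !mulmxA mulmxK // mulmxKV // mulmx_ebase.
Qed.

Lemma eqrank_submxC m n1 n2 (A : 'M[F]_(n1, m)) (B : 'M[F]_(n2, m)) :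
  \rank A = \rank B -> (A <= B)%MS = (B <= A)%MS.
Proof.
move=> rAB; apply/idP/idP => [/mxrank_leqif_sup|/mxrank_leqif_sup] [_ <-];
by rewrite rAB.
Qed.

Lemma mulmx_unit_eq0 m n (y : 'M[F]_m) (A : 'M_(m, n)) :
  y \in unitmx -> (y *m A == 0) = (A == 0).
Proof.
move=> uy; apply/eqP/eqP => [yA0 | ->]; last exact: mulmx0.
by rewrite -(mulKmx uy A) yA0 mulmx0.
Qed.

Lemma mulmx_eq0_unit m n (A : 'M_(m, n)) (z : 'M[F]_n) :
  z \in unitmx -> (A *m z == 0) = (A == 0).
Proof.
move=> uz; apply/eqP/eqP => [Az0 | ->]; last exact: mul0mx.
by rewrite -(mulmxK uz A) Az0 mul0mx.
Qed.

(** The condition says that [g] maps the [j]-dimensional column space of [f] into the kernel of [p],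
    of dimension [m - i]: an inclusion of subspaces, which for [i + j = m] is an equality. *)
Definition rank_sums_vanish m (phi : 'M[F]_m -> rat) (i j : nat) :=
  forall p f : 'M[F]_m, \rank p = i -> \rank f = j ->
  \sum_(g in unitmx | p *m g *m f == 0) phi g = 0.

Lemma rank_sums_vanish_tr m (phi : 'M[F]_m -> rat) i j :
  rank_sums_vanish phi i j -> rank_sums_vanish (phi \o trmx) j i.
Proof.
move=> phi0 p f rp rf; rewrite -[RHS](phi0 f^T p^T) ?mxrank_tr //.
rewrite [RHS](reindex_inj (@trmx_inj _ m m)) /=; apply: eq_bigl => g.
rewrite unitmx_tr -!trmx_mul mulmxA; congr (_ && _).
by rewrite -[RHS](inj_eq (@trmx_inj _ _ _)) trmxK trmx0.
Qed.

(* Adding to p the rows t outside its row space counts every g with p g f = 0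
   equally often, as t g f = 0 has q ^ (m - j) - q ^ i such solutions t. *)
Lemma rank_sums_vanish_pred m (phi : 'M[F]_m -> rat) i j :
  (i + j < m)%N -> rank_sums_vanish phi i.+1 j -> rank_sums_vanish phi i j.
Proof.
move=> lt_ij phi0 p f rp rf.
pose c := (#|F| ^ (m - j) - #|F| ^ i)%N.
have c0 : c%:R != 0 :> rat.
  rewrite pnatr_eq0 subn_eq0 -ltnNge ltn_exp2l ?card_finNzRing_gt1 //.
  by rewrite ltn_subRL addnC.
apply: (mulfI c0); rewrite mulr0 mulr_sumr.
transitivity (\sum_(t : 'rV[F]_m | ~~ (t <= p)%MS)
  \sum_(g in unitmx | (p + t)%MS *m g *m f == 0) phi g); last first.
  rewrite big1 // => t tNp; apply: phi0 => //; apply/anti_leq/andP; split.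
    rewrite (leq_trans (mxrank_adds_leqif p t)) // rp -[leqRHS]addn1 leq_add2l.
    exact: rank_leq_row.
  rewrite -rp rank_ltmx // ltmxE addsmxSl /=.
  by apply: contra tNp; apply: submx_trans; exact: addsmxSr.
under [RHS]eq_bigr do rewrite big_mkcondr; rewrite [RHS]exchange_big /=.
rewrite big_mkcondr; apply: eq_bigr => g ug.
have gf0 (t : 'rV_m) : ((p + t)%MS *m g *m f == 0) =
    (p *m g *m f == 0) && (t <= kermx (g *m f))%MS.
  by rewrite -!mulmxA -!sub_kermx addsmx_sub.
under eq_bigr do rewrite gf0.
case: ifP => [pgf|_]; last by rewrite big1.
rewrite -big_mkcondr sumr_const -[RHS]mulr_natl; congr (_%:R * _).
rewrite (@eq_card _ _ (rowg (kermx (g *m f)) :\: rowg p)) => [|t]; last first.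
  by rewrite !inE.
rewrite cardsD (setIidPr _); last by rewrite rowgS sub_kermx mulmxA.
rewrite !card_rowg mxrank_ker rp.
by rewrite (eqmxMfull f (_ : row_full g)) ?row_full_unit // rf.
Qed.

(** The first index is lowered one unit at a time, and transposition lets the second be lowered
    likewise. The bound [i + j <= m] makes each single step admissible. *)
Lemma rank_sums_vanish_le m (phi : 'M[F]_m -> rat) i j i' j' :
  (i + j <= m)%N -> (i' <= i)%N -> (j' <= j)%N ->
  rank_sums_vanish phi i j -> rank_sums_vanish phi i' j'.
Proof.
have down (psi : 'M[F]_m -> rat) d a b : (d + a + b <= m)%N ->
    rank_sums_vanish psi (d + a)%N b -> rank_sums_vanish psi a b.
  elim: d => [|d IH] // le_m psi0; apply: IH; first exact: ltnW.
  exact: rank_sums_vanish_pred.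
move=> le_ij le_i le_j phi0.
have phi1 : rank_sums_vanish phi i' j.
  by apply: (down phi (i - i')%N); rewrite subnK.
have {phi1}phi1 : rank_sums_vanish (phi \o trmx) j' i'.
  apply: (down _ (j - j')%N); rewrite subnK //.
    by rewrite addnC (leq_trans _ le_ij) // leq_add2r.
  exact: rank_sums_vanish_tr.
move=> p f rp rf; have := rank_sums_vanish_tr phi1 rp rf.
by under eq_bigr => g _ do rewrite /= trmxK.
Qed.

(** The matrix conditions say that [h] preserves the span of the first [l], respectively [k],
    coordinate columns. *)
Lemma sum_subspace_eq0 m l k (phi : 'M[F]_m -> rat) :
    (l <= m)%N -> (k <= l)%N -> (k <= m - l)%N ->
    (forall y z : 'M[F]_m, y \in unitmx -> z \in unitmx ->
      \sum_(h in unitmx | copid_mx l *m h *m pid_mx l == 0 :> 'M_m)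
         phi (y *m h *m z) = 0) ->
  forall y z : 'M[F]_m, y \in unitmx -> z \in unitmx ->
    \sum_(h in unitmx | copid_mx k *m h *m pid_mx k == 0 :> 'M_m)
       phi (y *m h *m z) = 0.
Proof.
move=> le_lm le_kl le_kml phi0 y z uy uz.
have le_km : (k <= m)%N by exact: leq_trans le_lm.
have sumE (r : nat) (y1 z1 : 'M[F]_m) : y1 \in unitmx -> z1 \in unitmx ->
    \sum_(h in unitmx | copid_mx r *m h *m pid_mx r == 0 :> 'M_m)
         phi (y1 *m h *m z1) =
    \sum_(g in unitmx | copid_mx r *m invmx y1 *m g *m (invmx z1 *m pid_mx r) == 0
       :> 'M_m) phi g.
  move=> uy1 uz1; rewrite sum_unit_translate //; apply: eq_bigl => g.
  by rewrite !mulmxA.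
have rpid r : (r <= m)%N -> \rank (pid_mx r : 'M[F]_m) = r.
  by move=> le_rm; rewrite rank_pid_mx.
have phi1 : rank_sums_vanish phi (m - l)%N l.
  move=> p f rp rf.
  have [|y1 [z1 [uy1 uz1 ->]]] := @eqrank_unitmx m (copid_mx l) p.
    by rewrite rank_copid_mx.
  have [|y2 [z2 [uy2 uz2 ->]]] := @eqrank_unitmx m (pid_mx l) f.
    by rewrite rpid.
  rewrite -[RHS](phi0 (invmx z1) (invmx y2)) ?unitmx_inv // sumE ?unitmx_inv //.
  apply: eq_bigl => g; rewrite !invmxK; congr (_ && _).
  by rewrite !mulmxA mulmx_eq0_unit // -!mulmxA mulmx_unit_eq0.
(* Every rank up to [k] is needed, as the [k]-row matrices [p] of the Fourier inversion below have
   arbitrary rank. *)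
have {phi1 phi0}phi0 i : (i <= k)%N -> rank_sums_vanish phi i k.
  move=> le_ik; apply: rank_sums_vanish_le phi1; rewrite ?subnK //.
  exact: leq_trans le_kml.
rewrite sumE //; set Q := copid_mx k *m invmx y.
set f0 : 'M_m := invmx z *m pid_mx k.
pose f1 : 'M[F]_(m, k) := y *m pid_mx k.
have rf0 : \rank f0 = k.
  by rewrite /f0 (eqmxMfull _ (_ : row_full (invmx z))) ?row_full_unit ?unitmx_inv ?rpid.
have rf1 : \rank f1 = k.
  by rewrite /f1 (eqmxMfull _ (_ : row_full y)) ?row_full_unit // rank_pid_mx.
have rQ : \rank Q = (m - k)%N.
  by rewrite mxrankMfree ?row_free_unit ?unitmx_inv ?rank_copid_mx.
have Qf1 : (kermx f1 :=: Q)%MS.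
  apply: eqmx_sym.
  apply/eqmxP; rewrite [X in _ && X]eqrank_submxC ?rQ ?mxrank_ker ?rf1 //.
  suff -> : (Q <= kermx f1)%MS by [].
  by apply/sub_kermxP; rewrite /Q /f1 mulmxA mulmxKV // mul_copid_mx_pid.
pose c : rat := (q - 1) * #|[pred p : 'M[F]_(k, m) | p *m f0 == 0]|%:R.
have c0 : c != 0.
  rewrite mulf_neq0 ?natr_card_F_neq1 // pnatr_eq0 -lt0n; apply/card_gt0P.
  by exists 0; rewrite inE mul0mx.
clearbody Q f0 f1; apply: (mulfI c0); rewrite mulr0.
transitivity (\sum_(g in unitmx) phi g *
  \sum_(p : 'M[F]_(k, m) | p *m (g *m f0) == 0) (q * (\tr (p *m f1) == 0)%:R - 1)).
  rewrite mulr_sumr big_mkcondr; apply: eq_bigr => g ug.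
  have rgf : \rank (g *m f0) = k.
    by rewrite (eqmxMfull _ (_ : row_full g)) ?row_full_unit.
  (* [g *m f0] and [f1] both have rank [k], so one left kernel contains the other only if they are
     equal; that of [f1] is the row space of [Q]. *)
  have condE : (kermx (g *m f0) *m f1 == 0) = (Q *m g *m f0 == 0).
    rewrite -sub_kermx Qf1 eqrank_submxC; first by rewrite sub_kermx mulmxA.
    by rewrite mxrank_ker rgf rQ.
  rewrite sum_trace_zero condE; case: ifP => _; last by rewrite !mulr0.
  rewrite mulrC; congr (_ * (_ * _%:R)); rewrite -!sum1_card.
  rewrite (reindex (fun p => p *m g)) /=.
    by apply: eq_bigl => p; rewrite !inE mulmxA.
  by exists (fun p => p *m invmx g) => p _; rewrite ?mulmxK ?mulmxKV.
under eq_bigr do rewrite mulr_sumr big_mkcond; rewrite exchange_big big1 //= => p _.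
rewrite -big_mkcondr -mulr_suml.
(* [<<p>>] is a square matrix with the row space of [p], the format of [rank_sums_vanish]. *)
have rp : (\rank <<p>>%MS <= k)%N by rewrite mxrank_gen rank_leq_row.
rewrite (eq_bigl (fun g => (g \in unitmx) && (<<p>>%MS *m g *m f0 == 0))).
  by rewrite (phi0 _ rp _ f0 erefl rf0) mul0r.
by move=> g; rewrite -[in RHS]mulmxA -!sub_kermx genmxE.
Qed.

End MatrixCounting.

(** * Functions summing to zero over translates of block groups *)

(* A composition is listed together with its marks, [true] for the blocks that
   carry a basis; the block group is the stabilizer of the corresponding flag
   of coordinate subspaces. *)
Notation blocks := (seq (nat * bool)).
Definition bsize (s : blocks) : nat := sumn (unzip1 s).

Lemma bsize_cat s t : bsize (s ++ t) = (bsize s + bsize t)%N.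
Proof. by rewrite /bsize /unzip1 map_cat sumn_cat. Qed.

Section BlockGroups.
Variable F : finFieldType.

(** The constraint at row [j] and column [k] of a block upper triangular matrix whose marked
    diagonal blocks are identities. Indices in [nat] avoid casts when blocks are regrouped. *)
Fixpoint entry_ok (s : blocks) (j k : nat) (x : F) : bool :=
  if s is (d, b) :: s' then
    if (k < d)%N then if b && (j < d)%N then x == (j == k)%:R
                      else (d <= j)%N ==> (x == 0)
    else (d <= j)%N ==> entry_ok s' (j - d) (k - d) x
  else true.

Definition pattern_mx s N (h : 'M[F]_N) := [forall j : 'I_N, forall k : 'I_N, entry_ok s j k (h j k)].

Definition block_group s N : pred 'M[F]_N := [pred h in unitmx | pattern_mx s h].

Definition vanishes s N (f : 'M[F]_N -> rat) := forall y z : 'M[F]_N,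
  y \in unitmx -> z \in unitmx ->
  \sum_(h | block_group s h) f (y *m h *m z) = 0.

(** Quantifying over all [f] lets a move be used inside a longer list, where it is applied to sums
    of [f] over fibres. *)
Definition leads s t := bsize s = bsize t /\
  forall N (f : 'M[F]_N -> rat), N = bsize s -> vanishes s f -> vanishes t f.

Lemma pattern_mxP s N (h : 'M[F]_N) :
  reflect (forall j k : 'I_N, entry_ok s j k (h j k)) (pattern_mx s h).
Proof.
apply: (iffP forallP) => [H j k | H j]; first by have /forallP := H j.
exact/forallP.
Qed.

Lemma entry_ok_cat s t j k x : entry_ok (s ++ t) j k x =
  if (k < bsize s)%N then entry_ok s j k x
  else (bsize s <= j)%N ==> entry_ok t (j - bsize s) (k - bsize s) x.
Proof.
elim: s j k => [|[d b] s IH] j k /=; first by rewrite !subn0.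
rewrite /bsize /= -/(bsize s) IH.
have [lt_kd|le_dk] := ltnP k d; first by rewrite ltn_addr.
rewrite -ltn_subLR // ?(leq_ltn_trans _ _) //.
rewrite !subnDA; case: (leqP d j) => [le_dj|lt_jd] /=.
  by rewrite leq_subRL.
by rewrite [(d + _ <= j)%N]leqNgt (ltn_addr _ lt_jd) /= if_same.
Qed.

Lemma entry_ok_low s j k x : (k < bsize s)%N -> (bsize s <= j)%N ->
  entry_ok s j k x = (x == 0).
Proof.
elim: s j k => [|[d b] s IH] j k //=.
rewrite /bsize /= -/(bsize s) => lt_k le_j.
have le_dj : (d <= j)%N by exact: leq_trans (leq_addr _ _) le_j.
rewrite [(j < d)%N]ltnNge le_dj andbF /=; case: ltnP => // le_dk.
by apply: IH; rewrite ?ltn_subLR ?leq_subRL.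
Qed.

Lemma pattern_mx_cat s t p q (h : 'M[F]_(p + q)) : bsize s = p ->
  pattern_mx (s ++ t) h =
  [&& pattern_mx s (ulsubmx h), dlsubmx h == 0 & pattern_mx t (drsubmx h)].
Proof.
move=> sp; apply/pattern_mxP/and3P => [H | [/pattern_mxP Hs /eqP dl0 /pattern_mxP Ht] j k].
  split; last 1 first.
  - apply/pattern_mxP => j k; have := H (rshift p j) (rshift p k).
    by rewrite entry_ok_cat sp /= ltnNge !leq_addr /= !addKn !mxE.
  - apply/pattern_mxP => j k; have := H (lshift q j) (lshift q k).
    by rewrite entry_ok_cat sp /= ltn_ord !mxE.
  apply/eqP/matrixP => j k; have := H (rshift p j) (lshift q k).
  by rewrite entry_ok_cat sp /= ltn_ord entry_ok_low ?sp ?leq_addr // !mxE => /eqP.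
rewrite entry_ok_cat sp.
have [k' -> | k' ->] := split_ordP k; have [j' -> | j' ->] := split_ordP j => /=.
- by have := Hs j' k'; rewrite !mxE.
- rewrite entry_ok_low ?sp ?leq_addr //.
  by have /matrixP/(_ j' k') := dl0; rewrite !mxE => ->.
- by rewrite leqNgt ltn_ord.
- by rewrite leq_addr !addKn; have := Ht j' k'; rewrite !mxE.
Qed.

Lemma pattern_mx_free m (h : 'M[F]_m) : pattern_mx [:: (m, false)] h.
Proof. by apply/pattern_mxP => j k /=; rewrite !ltn_ord leqNgt ltn_ord. Qed.

Lemma pattern_mx_marked m (h : 'M[F]_m) : pattern_mx [:: (m, true)] h = (h == 1%:M).
Proof.
apply/pattern_mxP/eqP => [H | -> j k /=]; last by rewrite !ltn_ord mxE.
by apply/matrixP => j k; have /= := H j k; rewrite !ltn_ord mxE => /eqP.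
Qed.

(** * One diagonal block inside a larger block group *)

Section Context.
Variables p m r : nat.
Implicit Types h : 'M[F]_(p + (m + r)).

Definition mid h : 'M_m := ulsubmx (drsubmx h).
Definition emb (x : 'M[F]_m) : 'M[F]_(p + (m + r)) :=
  block_mx 1%:M 0 0 (block_mx x 0 0 1%:M).

Lemma emb_mul x y : emb x *m emb y = emb (x *m y).
Proof.
by rewrite /emb !mulmx_block !(mulmx0, mul0mx, mulmx1, mul1mx, addr0, add0r).
Qed.

Lemma emb1 : emb 1%:M = 1%:M.
Proof. by rewrite /emb -!scalar_mx_block. Qed.

Lemma emb_unit x : x \in unitmx -> emb x \in unitmx.
Proof.
move=> ux; have : emb x *m emb (invmx x) = 1%:M by rewrite emb_mul mulmxV ?emb1.
by case/mulmx1_unit.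
Qed.

(** The diagonal blocks of an invertible block triangular matrix are invertible, so a finer pattern
    in the middle is a condition on [mid h] alone. *)
Lemma block_group_mid s1 t s2 h : bsize s1 = p -> bsize t = m ->
  block_group (s1 ++ t ++ s2) h =
  block_group (s1 ++ (m, false) :: s2) h && block_group t (mid h).
Proof.
move=> s1p tm; rewrite /block_group /= -cat1s !pattern_mx_cat //; last first.
  by rewrite /bsize /= addn0.
rewrite pattern_mx_free /=.
case uh: (h \in unitmx) => //=.
case: (pattern_mx s1 _) => //=; case: eqP => //= dl0.
case: (_ == 0) /eqP => //= dl1; last by rewrite andbF.
suff -> : mid h \in unitmx by rewrite andbC.
move: uh; rewrite -[h]submxK dl0 -[drsubmx h]submxK dl1 /mid.
rewrite block_mxKdr block_mxKul !unitmxE !det_ublock !unitrM.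
by case/and3P.
Qed.

Lemma block_group_emb s1 s2 y z h : bsize s1 = p ->
  y \in unitmx -> z \in unitmx ->
  block_group (s1 ++ (m, false) :: s2) (emb y *m h *m emb z) =
    block_group (s1 ++ (m, false) :: s2) h.
Proof.
have half y1 z1 h1 : bsize s1 = p -> y1 \in unitmx -> z1 \in unitmx ->
  block_group (s1 ++ (m, false) :: s2) h1 ->
  block_group (s1 ++ (m, false) :: s2) (emb y1 *m h1 *m emb z1).
  move=> s1p uy uz; rewrite /block_group /= -cat1s.
  have sm : bsize [:: (m, false)] = m by rewrite /bsize /= addn0.
  rewrite !pattern_mx_cat //.
  rewrite !unitmx_mul !emb_unit //= andbT => /and4P[-> A1 /eqP dl0].
  case/and3P=> _ /eqP dl1 A2 /=.
  rewrite -[h1]submxK dl0 -[drsubmx h1]submxK dl1 /emb.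
  rewrite !mulmx_block !(mulmx0, mul0mx, mulmx1, mul1mx, addr0, add0r).
  rewrite !(block_mxKul, block_mxKdl, block_mxKdr) mulmx_block.
  rewrite !(block_mxKul, block_mxKdl, block_mxKdr).
  rewrite !(mulmx0, mul0mx, mulmx1, mul1mx, addr0, add0r) A1 A2.
  by rewrite pattern_mx_free !eqxx.
move=> s1p uy uz; apply/idP/idP; last exact: half.
move/(half (invmx y) (invmx z)); rewrite !unitmx_inv => /(_ s1p uy uz).
rewrite -!mulmxA !emb_mul mulmxV // emb1 mulmx1 !mulmxA emb_mul mulVmx //.
by rewrite emb1 mul1mx.
Qed.

Lemma mid_emb s1 s2 y z h : bsize s1 = p ->
  block_group (s1 ++ (m, false) :: s2) h ->
  mid (emb y *m h *m emb z) = y *m mid h *m z.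
Proof.
move=> s1p; rewrite /block_group /= -cat1s.
rewrite !pattern_mx_cat //; last by rewrite /bsize /= addn0.
case/and4P=> _ _ /eqP dl0 /and3P[_ /eqP dl1 _].
rewrite /mid -[h]submxK dl0 -[drsubmx h]submxK dl1 /emb.
rewrite !mulmx_block !(mulmx0, mul0mx, mulmx1, mul1mx, addr0, add0r).
rewrite !(block_mxKul, block_mxKdl, block_mxKdr) mulmx_block.
by rewrite !block_mxKul !(mulmx0, mul0mx, mulmx1, mul1mx, addr0, add0r).
Qed.

End Context.

(* For h in the larger group with a free middle block, the sum of f over all h
   with given middle block x is a function of x satisfying the hypothesis. *)
Lemma leads_context s1 s2 t t' : leads t t' -> leads (s1 ++ t ++ s2) (s1 ++ t' ++ s2).
Proof.
move=> [tt' leads_tt']; split; first by rewrite !bsize_cat tt'.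
move=> N f; rewrite !bsize_cat.
move Ep: (bsize s1) => p; move Em: (bsize t) => m; move: (bsize s2) => r eN.
subst N => vf a b ua ub.
pose Q := s1 ++ (m, false) :: s2.
pose phi x := \sum_(h | block_group Q h && (mid h == x)) f (a *m h *m b).
(* Multiplying [x] by [y] and [z] amounts to multiplying [h] by their embeddings, which preserve the
   larger group; so sums of [phi] over translates are sums of [f] over translates. *)
have sum_phi u y z : bsize u = m -> y \in unitmx -> z \in unitmx ->
    \sum_(x | block_group u x) phi (y *m x *m z) =
    \sum_(h : 'M_(p + (m + r)) | block_group (s1 ++ u ++ s2) h)
       f ((a *m emb p r y) *m h *m (emb p r z *m b)).
  move=> um uy uz.
  rewrite [RHS](partition_big (@mid p m r) (@block_group u m)) /=; last first.
    by move=> h; rewrite (block_group_mid _ _ Ep um) => /andP[].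
  apply: eq_bigr => x ux; rewrite /phi.
  have emb_inv w : w \in unitmx -> emb p r (invmx w) *m emb p r w = 1%:M.
    by move=> uw; rewrite emb_mul mulVmx ?emb1.
  have emb_inv' w : w \in unitmx -> emb p r w *m emb p r (invmx w) = 1%:M.
    by move=> uw; rewrite emb_mul mulmxV ?emb1.
  rewrite (reindex (fun h => emb p r y *m h *m emb p r z)) /=; last first.
    exists (fun h => emb p r (invmx y) *m h *m emb p r (invmx z)) => h _.
      by rewrite !mulmxA emb_inv // mul1mx -mulmxA emb_inv' // mulmx1.
    by rewrite !mulmxA emb_inv' // mul1mx -mulmxA emb_inv // mulmx1.
  apply: eq_big => [h | h _]; last by rewrite !mulmxA.
  rewrite (block_group_mid _ _ Ep um) (block_group_emb _ _ Ep) //.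
  case Qh: (block_group _ h) => //=.
  rewrite (mid_emb _ _ Ep Qh) (can_eq (mulmxK uz)) (can_eq (mulKmx uy)).
  by case: eqP => [->|]; rewrite ?andbF // ux.
have u1 : (1%:M : 'M[F]_m) \in unitmx by exact: unitmx1.
have um' : bsize t' = m by rewrite -tt' Em.
have := sum_phi t' 1%:M 1%:M um' u1 u1; rewrite emb1 mulmx1 mul1mx => <-.
apply: (leads_tt' m phi) => // y z uy uz; rewrite sum_phi //.
by apply: vf; rewrite unitmx_mul emb_unit ?ua ?ub.
Qed.

(** * Composition of moves, and the elementary moves *)

Lemma leads_refl s : leads s s.
Proof. by split. Qed.

Lemma leads_trans s t u : leads s t -> leads t u -> leads s u.
Proof.
move=> [st H1] [tu H2]; split; first exact: etrans tu.
by move=> N f Ns /(H1 N f Ns); apply: H2; rewrite Ns.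
Qed.

Lemma leads_cat s s' t t' : leads s s' -> leads t t' -> leads (s ++ t) (s' ++ t').
Proof.
move=> ss' tt'; apply: (@leads_trans _ (s' ++ t)).
  exact: (@leads_context [::]).
by have := @leads_context s' [::] _ _ tt'; rewrite !cats0.
Qed.

Lemma leads_cons x t t' : leads t t' -> leads (x :: t) (x :: t').
Proof. exact: (@leads_cat [:: x] [:: x] _ _ (leads_refl _)). Qed.

(** Translates of the trivial group are single matrices, so [f] vanishes at every unit and each term
    of the new sum is zero. *)
Lemma leads_marked a t : bsize t = a -> leads [:: (a, true)] t.
Proof.
move=> ta; split=> [|N f]; first by rewrite ta /bsize /= addn0.
rewrite [bsize _]addn0 => eN; subst N => vf y z uy uz.
rewrite big1 // => h /andP[uh _].
have := vf (y *m h) z; rewrite unitmx_mul uy uh => /(_ isT uz).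
rewrite (big_pred1 1%:M) ?mulmx1 // => g; rewrite /block_group /= pattern_mx_marked.
by apply: andb_idl => /eqP->; exact: unitmx1.
Qed.

(** Lists may contain blocks of size 0, unlike compositions; this serves to pad two lists to a
    common length. *)
Lemma leads_size0 s t : bsize s = 0%N -> bsize t = 0%N -> leads s t.
Proof.
move=> s0 t0; split=> [|N f]; first by rewrite s0.
rewrite s0 => N0; subst N => vf y z uy uz; rewrite -[RHS](vf y z uy uz).
by apply: eq_bigl => h; congr (_ && _); apply/pattern_mxP/pattern_mxP => _ [].
Qed.

(** The first group fixes the first [a] coordinate columns; members of the second have the last [a]
    rows of the identity. [sum_coimage_eq0] passes from one to its dual. *)
Lemma leads_swap a b : leads [:: (a, true); (b, false)] [:: (b, false); (a, true)].
Proof.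
rewrite /leads /bsize /= !addn0 addnC; split=> // m f m_ba vf y z uy uz.
have le_am : (a <= m)%N by rewrite m_ba leq_addl.
pose w := widen_ord le_am.
have lt_v (i : 'I_a) : (b + i < m)%N by rewrite m_ba ltn_add2l.
pose v i := Ordinal (lt_v i).
have pidE : pid_mx a = colsub w 1%:M :> 'M[F]_(m, a).
  by apply/matrixP => j k; rewrite !mxE /= -val_eqE /=; case: eqP => //= ->; rewrite ltn_ord.
have vf' y1 z1 : y1 \in unitmx -> z1 \in unitmx ->
    \sum_(h in unitmx | h *m pid_mx a == pid_mx a :> 'M_(m, a)) f (y1 *m h *m z1) = 0.
  move=> uy1 uz1; rewrite -[RHS](vf y1 z1 uy1 uz1); apply: eq_bigl => h.
  rewrite pidE mulmx_colsub mulmx1 /block_group /=; congr (_ && _).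
  apply/eqP/pattern_mxP => [H j k /= | H].
    case: ltnP => [lt_ka | le_ak].
      have /matrixP/(_ j (Ordinal lt_ka)) := H.
      rewrite !mxE (_ : w _ = k) => [->|]; last exact: val_inj.
      rewrite -val_eqE /=; case: ltnP => [_ | le_aj] /=; first exact: eqxx.
      by rewrite gtn_eqF ?eqxx // (leq_trans lt_ka).
    apply/implyP => le_aj; case: ifP => _; last by rewrite implybT.
    by rewrite leq_subRL // leqNgt addnC -m_ba ltn_ord.
  apply/matrixP => j k; have := H j (w k); rewrite !mxE /= ltn_ord.
  rewrite -val_eqE /=; case: ltnP => /= [_ /eqP // | le_aj /eqP->].
  by rewrite gtn_eqF // (leq_trans (ltn_ord k)).
have admE (h : 'M[F]_m) :
    pattern_mx [:: (b, false); (a, true)] h = (rowsub v h == rowsub v 1%:M).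
  apply/pattern_mxP/eqP => [H | H j k /=].
    apply/matrixP => j k; have := H (v j) k; rewrite !mxE /= leq_addr addKn ltn_ord.
    rewrite -val_eqE /=; case: ltnP => [lt_kb /eqP->|le_bk].
      by rewrite gtn_eqF // (leq_trans lt_kb) ?leq_addr.
    rewrite ltn_subLR // -m_ba ltn_ord /= => /eqP->.
    by rewrite -(eqn_add2l b) subnKC.
  case: (leqP b j) => [le_bj | lt_jb] /=; last by case: ifP.
  have lt_j : (j - b < a)%N by rewrite ltn_subLR // -m_ba.
  have lt_k : (k < b)%N = false -> (k - b < a)%N.
    by move/negbT; rewrite -leqNgt => le_bk; rewrite ltn_subLR // -m_ba.
  have /matrixP/(_ (Ordinal lt_j) k) := H.
  rewrite !mxE (_ : v _ = j); last by apply: val_inj; rewrite /= subnKC.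
  rewrite -val_eqE /= => ->; case: ifP => [lt_kb | ge_kb].
    by rewrite gtn_eqF // (leq_trans lt_kb).
  have le_bk : (b <= k)%N by rewrite leqNgt ge_kb.
  by rewrite lt_k // lt_j -[(j - b)%N == _](eqn_add2l b) !subnKC.
(* For [h = invmx y *m g *m invmx z], the condition on the last rows of [h] reads [p1 *m g = p0],
   with [p1] and [p0] the last rows of [invmx y] and [z]. *)
rewrite -[RHS](sum_coimage_eq0 vf' (rowsub v z) (rowsub v (invmx y))).
rewrite sum_unit_translate //; apply: eq_bigl => g /=; congr (_ && _).
rewrite admE -(can_eq (mulmxK uz)) -mul_rowsub_mx mulmxKV // mul_rowsub_mx.
by rewrite mul1mx mul_rowsub_mx.
Qed.

Lemma leads_split x y k : (k <= x)%N -> (k <= y)%N ->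
  leads [:: (x, false); (y, false)] [:: (k, false); (x + y - k, false)]%N.
Proof.
move=> le_kx le_ky; have le_kxy : (k <= x + y)%N by exact: leq_trans (leq_addr _ _).
split; first by rewrite /bsize /= !addn0 subnKC.
rewrite /bsize /= addn0 => m f m_xy.
(* With two unmarked blocks only the lower left corner is constrained, and the factors [copid_mx r]
   and [pid_mx r] cut it out. *)
have admE r (h : 'M[F]_m) : (r <= m)%N ->
    pattern_mx [:: (r, false); (m - r, false)]%N h =
    (copid_mx r *m h *m pid_mx r == 0 :> 'M_m).
  move=> le_rm.
  have E : copid_mx r *m h *m pid_mx r = \matrix_(i, j) (if (j < r <= i)%N then h i j else 0) :> 'M_m.
    apply/matrixP => i j; rewrite !mxE (bigD1 j) //= big1 => [|l /negPf lj]; last first.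
      by rewrite [X in _ * X]mxE /= (_ : (l : nat) == j = false) ?mulr0.
    rewrite [X in _ * X]mxE eqxx addr0 /= mxE (bigD1 i) //= big1 => [|l /negPf il].
      rewrite /copid_mx !mxE eqxx /= addr0; case: (ltnP j r) => _; rewrite ?mulr0 //.
      by case: (ltnP i r) => _; rewrite eqxx /= ?subrr ?subr0 !(mul0r, mul1r, mulr1).
    by rewrite /copid_mx !mxE eq_sym il [(i : nat) == l]eq_sym (il : (l : nat) == i = false) subr0 mul0r.
  rewrite E; apply/pattern_mxP/eqP => [H | /matrixP H i j /=].
    apply/matrixP => i j; rewrite !mxE; case: (ltnP j r) => //= lt_jr.
    by case: leqP => //= le_ri; have := H i j; rewrite /= lt_jr le_ri => /eqP.
  case: (leqP r i) => //=; last by case: ifP.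
  move=> le_ri; have := H i j; rewrite !mxE le_ri andbT; case: (ltnP j r) => [_ ->|le_rj _] //.
  by case: ifP => // _; rewrite leq_sub2rE // leqNgt ltn_ord.
rewrite -m_xy /vanishes /block_group /=.
have -> : y = (m - x)%N by rewrite m_xy addKn.
move=> vf y1 z1 uy1 uz1.
under eq_bigl do rewrite admE ?m_xy //.
apply: (@sum_subspace_eq0 F m x k f); rewrite ?m_xy ?leq_addr ?addKn // => y2 z2 uy2 uz2.
rewrite -[RHS](vf y2 z2 uy2 uz2); apply: eq_bigl => h.
by rewrite admE // m_xy leq_addr.
Qed.

End BlockGroups.

(** * Flags and block groups *)

(** The recursion unfolds into the conditions for stabilizing a flag: the columns of the first
    [i.+1] blocks vanish below these blocks, so the subspace is preserved; the columns of a marked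
    block agree with the identity from its first row on, so its basis is fixed modulo the preceding
    subspace. *)
Lemma entry_okP (F : finFieldType) (s : blocks) j k (x : F) :
  reflect (forall i, (i < size s)%N ->
      ((k < sumn (take i.+1 (unzip1 s)) <= j)%N -> x = 0) /\
      (nth false (unzip2 s) i ->
       (sumn (take i (unzip1 s)) <= k < sumn (take i.+1 (unzip1 s)))%N ->
       (sumn (take i (unzip1 s)) <= j)%N -> x = (j == k)%:R))
    (entry_ok s j k x).
Proof.
apply: (iffP idP).
  elim: s j k => [|[d b] s IH] j k //= s_adm [_|i lt_i] /=.
    rewrite take0 /= addn0; split.
      by case/andP=> lt_kd le_dj; move: s_adm; rewrite lt_kd ltnNge le_dj andbF /= => /eqP.
    move=> bT lt_kd _; move: s_adm; rewrite lt_kd bT /=.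
    case: ltnP => [_ /eqP //|le_dj /eqP->].
    by rewrite gtn_eqF // (leq_trans lt_kd).
  move: s_adm; case: (ltnP k d) => [lt_kd s_adm | le_dk s_adm].
    split=> [/andP[_ le_j]|_ /andP[le_k _]]; last by lia.
    have le_dj : (d <= j)%N by lia.
    by move: s_adm; rewrite ltnNge le_dj andbF /= => /eqP.
  have le_dj_adm : (d <= j)%N -> entry_ok s (j - d) (k - d) x by move/implyP: s_adm.
  split=> [/andP[lt_k le_j]|bT /andP[le_k lt_k] le_j].
    have /le_dj_adm/IH/(_ i lt_i)[-> //] : (d <= j)%N by lia.
    by lia.
  have le_dj : (d <= j)%N by lia.
  have /IH/(_ i lt_i)[_ ->//] := le_dj_adm le_dj; try lia.
  by congr _%:R; lia.
elim: s j k => [|[d b] s IH] j k //= H.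
have /= [H1 H2] := H 0%N isT; move: H1 H2; rewrite take0 /= addn0 => H1 H2.
case: ltnP => [lt_kd|le_dk].
  case: b {H} H2 => /= H2; last by apply/implyP => le_dj; rewrite H1 ?lt_kd.
  by case: ltnP => /= lt_jd; [rewrite H2 | rewrite H1 ?lt_kd].
apply/implyP => le_dj; apply: IH => i lt_i.
have /= [H3 H4] := H i.+1 lt_i; split; first by move=> lt_k; apply: H3; lia.
by move=> bT le_k le_j; rewrite H4 //; try lia; congr _%:R; lia.
Qed.

Section Bridge.
Variables (F : finFieldType) (n : nat).
Local Notation N := n.-1.+1.
Local Notation V := (vecs F n).
Implicit Types (X Y : seq V) (g h : {'GL_n[F]}).

Definition std_basis : seq V := [seq delta_mx j 0 | j <- enum 'I_N].

Lemma size_std_basis : size std_basis = N.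
Proof. by rewrite size_map size_enum_ord. Qed.

Lemma nth_std_basis (j : 'I_N) : std_basis`_j = delta_mx j 0.
Proof. by rewrite (nth_map j) ?size_enum_ord // nth_ord_enum. Qed.

Lemma vec_std_basis (v : V) : v = \sum_(j < N) v j 0 *: std_basis`_j.
Proof.
rewrite [LHS]matrix_sum_delta; apply: eq_bigr => j _.
by rewrite big_ord1 nth_std_basis.
Qed.

Lemma free_std_basis : free std_basis.
Proof.
suff: free (Tuple (introT eqP size_std_basis)) by [].
apply/freeP => k /= sum0 i.
have /matrixP/(_ i 0) := sum0; rewrite summxE (bigD1 i) //= big1 => [|j /negPf ji].
  by rewrite nth_std_basis !mxE !eqxx mulr1 addr0.
by rewrite nth_std_basis !mxE eq_sym ji mulr0.
Qed.

Lemma mem_span_std t (v : V) :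
  reflect (forall j : 'I_N, (t <= j)%N -> v j 0 = 0) (v \in <<take t std_basis>>%VS).
Proof.
apply: (iffP idP) => [|v0].
  move/(@coord_span _ _ _ (in_tuple _)) => vE j le_tj; rewrite vE summxE.
  rewrite big1 // => i _; have lt_i := ltn_ord i.
  have [lt_it lt_iN] : (i < t)%N /\ (i < N)%N.
    move: (nat_of_ord i) lt_i => {}i; rewrite size_take size_std_basis.
    by case: ifP; lia.
  rewrite mxE nth_take // -[(i : nat)]/(Ordinal lt_iN : nat) nth_std_basis mxE.
  by rewrite -val_eqE /= gtn_eqF ?mulr0 // (leq_trans lt_it).
rewrite (vec_std_basis v); apply: memv_suml => j _.
case: (leqP t j) => [/v0 -> | lt_jt]; first by rewrite scale0r mem0v.
apply/memvZ/memv_span; rewrite -(nth_take _ lt_jt); apply: mem_nth.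
by rewrite size_take size_std_basis; case: ifP.
Qed.

Local Notation "g ** X" := (map (mulmx (GLval g)) X) (at level 40).

Lemma mulGX g h X : (g * h)%g ** X = g ** (h ** X).
Proof. by rewrite -map_comp; apply: eq_map => v /=; rewrite mulmxA. Qed.

Lemma mul1X X : (1%g : {'GL_n[F]}) ** X = X.
Proof. by rewrite map_id_in // => v _; rewrite GL_1E mul1mx. Qed.

Lemma act_space_span g X : act_space g <<X>>%VS = <<g ** X>>%VS.
Proof. by rewrite /act_space limg_span; congr span; apply: eq_map => v; rewrite lfunE. Qed.

Lemma GL_mulK g : cancel (mulmx (GLval g) : V -> V) (mulmx (GLval g^-1%g)).
Proof. by move=> v; rewrite GL_VE mulKmx ?GL_unitmx. Qed.

Lemma GL_mulVK g : cancel (mulmx (GLval g^-1%g) : V -> V) (mulmx (GLval g)).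
Proof. by move=> v; rewrite GL_VE mulKVmx ?GL_unitmx. Qed.

Lemma mem_act_space g U (v : V) : (GLval g *m v \in act_space g U) = (v \in U).
Proof.
rewrite -(lfunE (mulmx (GLval g))); apply/memv_imgP/idP => [[w wU]|vU]; last by exists v.
by rewrite !lfunE => /(can_inj (GL_mulK g))->.
Qed.

Lemma act_coset_vcoset g U v :
  act_coset g (vcoset U v) = vcoset (act_space g U) (GLval g *m v).
Proof.
apply/setP => x; rewrite -(GL_mulVK g x) mem_imset ?inE; last exact/can_inj/GL_mulK.
by rewrite -mulmxBr mem_act_space.
Qed.

Lemma free_mulX g X : free (g ** X) = free X.
Proof.
rewrite /free size_map -act_space_span limg_dim_eq //; apply/eqP.
rewrite -subv0; apply/subvP => v; rewrite memv_cap memv_ker lfunE memv0 => /andP[_ gv0].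
by rewrite -(GL_mulK g v) (eqP gv0) mulmx0.
Qed.

Lemma free_mul_std X : size X = N -> free X -> exists g, X = g ** std_basis.
Proof.
move=> szX freeX; pose A : 'M[F]_N := \matrix_(i, j) (X`_j) i 0.
have AE (v : V) : A *m v = \sum_(j < N) v j 0 *: X`_j.
  apply/colP => i; rewrite mxE summxE; apply: eq_bigr => j _.
  by rewrite !mxE mulrC.
have uA : A \in unitmx.
  rewrite -unitmx_tr -row_free_unit; apply: inj_row_free => v vA0.
  have Av0 : A *m v^T = 0 by rewrite -[A]trmxK -trmx_mul vA0 trmx0.
  apply/rowP => j; rewrite mxE.
  have /freeP/(_ (fun j => v^T j 0)) : free (Tuple (introT eqP szX)) by [].
  by rewrite -AE Av0 => /(_ erefl j); rewrite mxE.
exists (FinRing.Unit uA); apply: (@eq_from_nth _ 0) => [|i].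
  by rewrite size_map size_std_basis.
rewrite szX => lt_i; rewrite (nth_map 0) ?size_std_basis //=.
rewrite -[i]/(Ordinal lt_i : nat) nth_std_basis -colE.
by apply/colP => k; rewrite !mxE.
Qed.

(** * Flags obtained from ordered bases of the whole space *)

Variable alpha : flag_shape.
Local Notation d := (dims alpha).
Local Notation S i := (sumn (take i d)).

(** This reduces flags to ordered bases of the whole space, on which the group acts simply
    transitively. *)
Definition flag_of X : flag_data F n alpha :=
  ([tuple <<take (S i.+1) X>>%VS | i < size d],
   [ffun i : {i : 'I_(size d) | i \in marked alpha} => [seq vcoset <<take (S (val i)) X>>%VS v
              | v <- take (nth 0%N d (val i)) (drop (S (val i)) X)]]).

Lemma flag_space_of X i : (i <= size d)%N ->
  flag_space (flag_of X) i = <<take (S i) X>>%VS.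
Proof.
case: i => [|i] lt_i; first by rewrite take0 /= take0 span_nil.
rewrite /flag_space /= (nth_map (Ordinal lt_i)) ?size_enum_ord //.
by rewrite -[i in nth _ _ i]/(Ordinal lt_i : nat) nth_ord_enum.
Qed.

Lemma act_flag_of g X : act_flag g (flag_of X) = flag_of (g ** X).
Proof.
congr pair.
  apply: val_inj => /=; rewrite -map_comp; apply: eq_map => i /=.
  by rewrite act_space_span map_take.
apply/ffunP => i; rewrite !ffunE -map_comp -map_drop -map_take -map_comp.
by apply: eq_map => v /=; rewrite act_coset_vcoset act_space_span map_take.
Qed.

Lemma free_takeX t X : free X -> free (take t X).
Proof. by rewrite -{1}(cat_take_drop t X) => /catl_free. Qed.

Lemma dim_span_take t X : free X -> (t <= size X)%N -> \dim <<take t X>> = t.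
Proof. by move=> /(free_takeX t)/eqP-> le_t; rewrite size_takel. Qed.

Lemma sumn_takeS i : (i < size d)%N -> S i.+1 = (S i + nth 0%N d i)%N.
Proof. by move=> lt_i; rewrite (take_nth 0%N lt_i) sumn_rcons. Qed.

Lemma quotient_basis_cat (A B : seq V) : free (A ++ B) ->
  quotient_basis <<A>>%VS <<A ++ B>>%VS [seq vcoset <<A>>%VS v | v <- B].
Proof.
rewrite cat_free span_cat => /and3P[_ freeB /directv_addP AB0]; exists B; split=> //.
- by move=> v vB; apply: (subvP (addvSr _ _)); exact: memv_span.
- move=> k kA; have /freeP : free (in_tuple B) by []; apply.
  apply/eqP; rewrite -memv0 -AB0 memv_cap kA /=.
  by apply: memv_suml => j _; apply/memvZ/memv_span/mem_nth.
move=> w /memv_addP[u uA [v vB ->]]; exists (fun j => coord (in_tuple B) j v).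
by rewrite -(@coord_span _ _ _ (in_tuple B) _ vB) addrK.
Qed.

Lemma free_cat_quotient (A B : seq V) (W : {vspace V}) : free A -> (<<A>> <= W)%VS ->
  {subset B <= W} ->
  (forall k : 'I_(size B) -> F,
     \sum_(j < size B) k j *: B`_j \in <<A>>%VS -> forall j, k j = 0) ->
  (forall w, w \in W -> exists k : 'I_(size B) -> F,
     w - \sum_(j < size B) k j *: B`_j \in <<A>>%VS) ->
  free (A ++ B) /\ <<A ++ B>>%VS = W.
Proof.
move=> freeA AW BW indepB spanB; split.
  rewrite cat_free freeA /=; apply/andP; split.
    suff: free (in_tuple B) by [].
    by apply/freeP => k sum0; apply: indepB; rewrite sum0 mem0v.
  apply/directv_addP/eqP; rewrite -subv0; apply/subvP => v.
  rewrite memv_cap memv0 => /andP[vA /(@coord_span _ _ _ (in_tuple B)) vE].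
  move: vA; rewrite vE => /indepB c0; apply/eqP; apply: big1 => j _.
  by rewrite c0 scale0r.
apply/eqP; rewrite eqEsubv span_cat subv_add AW /=; apply/andP; split.
  exact/span_subvP.
apply/subvP => w /spanB[k kA]; rewrite -(subrK (\sum_(j < size B) k j *: B`_j) w).
apply: memv_add => //; apply: memv_suml => j _.
exact/memvZ/memv_span/mem_nth.
Qed.

Hypothesis sum_d : sumn d = N.

Lemma le_S i : (S i <= N)%N.
Proof. by rewrite -sum_d -[in leqRHS](cat_take_drop i d) sumn_cat leq_addr. Qed.

Lemma is_flag_of X : size X = N -> free X -> is_flag (flag_of X).
Proof.
move=> szX freeX; have le_SX i : (S i <= size X)%N by rewrite szX le_S.
have takeS i : (i < size d)%N ->
    take (S i.+1) X = take (S i) X ++ take (nth 0%N d i) (drop (S i) X).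
  by move=> lt_i; rewrite sumn_takeS // takeD.
split=> [i||i].
- rewrite !flag_space_of ?(ltnW (ltn_ord i)) //; split.
    by rewrite takeS // span_cat addvSl.
  by rewrite !dim_span_take // sumn_takeS.
- rewrite flag_space_of // take_size sum_d take_oversize ?szX //; apply/eqP.
  by rewrite eqEdim subvf dimvf (eqP freeX) szX /dim /= muln1 leqnn.
have lt_i := ltn_ord (val i).
rewrite !flag_space_of ?(ltnW lt_i) // ffunE takeS //; apply: quotient_basis_cat.
by rewrite -takeS // free_takeX.
Qed.

(** An adapted basis grows along the flag: at a marked step representatives of the given quotient
    basis are appended, at an unmarked step any basis of a complement. *)
Lemma flag_of_ex (a : flag_data F n alpha) : is_flag a ->
  exists X, [/\ size X = N, free X & a = flag_of X].
Proof.
case=> a_step a_full a_basis.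
have adapted m : (m <= size d)%N -> exists X, [/\ free X, size X = S m,
    (forall j, j <= m -> flag_space a j = <<take (S j) X>>%VS)%N &
    (forall i : {i : 'I_(size d) | i \in marked alpha}, (val i < m)%N ->
       a.2 i = [seq vcoset <<take (S (val i)) X>>%VS v
               | v <- take (nth 0%N d (val i)) (drop (S (val i)) X)])].
  elim: m => [_|m IH lt_m].
    exists [::]; split=> // [||j]; first by rewrite /free span_nil dimv0.
      by rewrite take0.
    by rewrite leqn0 => /eqP->; rewrite span_nil.
  have [X [freeX szX spanX cosX]] := IH (ltnW lt_m).
  pose i0 := Ordinal lt_m; have [/= sub_m dim_m] := a_step i0.
  have spanXm : flag_space a m = <<X>>%VS by rewrite spanX // -szX take_size.
  have [B [freeXB spanXB cosB]] : exists B, [/\ free (X ++ B),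
      <<X ++ B>>%VS = flag_space a m.+1 &
      forall i : {i : 'I_(size d) | i \in marked alpha}, val i = i0 ->
        a.2 i = [seq vcoset <<X>>%VS v | v <- B]].
    case: (boolP (i0 \in marked alpha)) => [mk_m | unmk_m].
      have := a_basis (exist _ i0 mk_m); rewrite /= spanXm => -[B [csB BW indepB spanB]].
      have [] := free_cat_quotient freeX _ BW indepB spanB; first by rewrite -spanXm.
      move=> freeXB spanXB; exists B; split=> // i i_m; rewrite -csB; congr (a.2 _).
      exact: val_inj.
    exists (vbasis (flag_space a m.+1 :\: <<X>>)%VS).
    have bas := vbasisP (flag_space a m.+1 :\: <<X>>)%VS.
    rewrite cat_free span_cat (span_basis bas) freeX (basis_free bas) /=.
    split.
    - by apply/directv_addP; rewrite capvC capv_diff.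
    - by rewrite addvC addv_diff; apply/addv_idPl; rewrite -spanXm.
    by move=> [i mk_i] /= i_m; move: unmk_m; rewrite -i_m mk_i.
  have szB : size B = nth 0%N d m.
    have := eqP freeXB; rewrite spanXB dim_m spanXm (eqP freeX) size_cat.
    by move/addnI.
  exists (X ++ B); split=> //.
  - by rewrite size_cat szX szB sumn_takeS.
  - move=> j; rewrite leq_eqVlt => /predU1P[-> | lt_j].
      by rewrite sumn_takeS // -szB -szX -size_cat take_size spanXB.
    rewrite spanX // takel_cat // szX.
    by rewrite -(subnKC (lt_j : (j <= m)%N)) takeD sumn_cat leq_addr.
  move=> i; rewrite ltnS leq_eqVlt => /predU1P[i_m | lt_i].
    rewrite i_m -szB -szX take_size_cat // drop_size_cat // take_size.
    by apply: cosB; exact: val_inj.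
  have le_SX : (S (val i).+1 <= size X)%N.
    by rewrite szX -(subnKC lt_i) takeD sumn_cat leq_addr.
  rewrite cosX //; have := le_SX; rewrite sumn_takeS // => le_iX.
  have le_iX' : (S (val i) <= size X)%N by exact: leq_trans (leq_addr _ _) le_iX.
  by rewrite takel_cat // !take_drop takel_cat // addnC.
have [X [freeX]] := adapted _ (leqnn _).
rewrite take_size sum_d => szX spanX cosX; exists X; split=> //.
rewrite [a]surjective_pairing /flag_of; congr pair.
  apply: eq_from_tnth => i; rewrite tnth_mktuple -spanX //.
  by rewrite /flag_space /= (tnth_nth 0%VS).
by apply/ffunP => i; rewrite ffunE cosX.
Qed.

Lemma size_mul_std g : size (g ** std_basis) = N.
Proof. by rewrite size_map size_std_basis. Qed.

Lemma mul_std_basis_coef g (j k : 'I_N) :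
  (GLval g *m std_basis`_k) j 0 = GLval g j k.
Proof. by rewrite nth_std_basis -colE mxE. Qed.

Lemma nth_mul_std_basis g (k : 'I_N) : (g ** std_basis)`_k = GLval g *m std_basis`_k.
Proof. by rewrite (nth_map 0) ?size_std_basis. Qed.

Lemma span_take_std_mul g t : (t <= N)%N ->
  reflect (forall j k : 'I_N, (k < t <= j)%N -> GLval g j k = 0)
    (<<take t (g ** std_basis)>>%VS == <<take t std_basis>>%VS).
Proof.
move=> le_tN; rewrite eqEdim.
rewrite !dim_span_take ?size_mul_std ?size_std_basis ?free_mulX ?free_std_basis //.
rewrite leqnn andbT; apply: (iffP span_subvP) => [sub j k /andP[lt_kt le_tj]|g0 v].
  rewrite -mul_std_basis_coef -nth_mul_std_basis.
  apply: (mem_span_std _ _ (sub _ _)) => //; rewrite -(nth_take _ lt_kt).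
  by apply: mem_nth; rewrite size_takel // size_mul_std.
case/(nthP 0) => k; rewrite size_takel ?size_mul_std // => lt_kt <-.
rewrite nth_take //; have lt_kN := leq_trans lt_kt le_tN.
rewrite -[k]/(Ordinal lt_kN : nat) nth_mul_std_basis.
by apply/mem_span_std => j le_tj; rewrite mul_std_basis_coef g0 //= lt_kt.
Qed.

Lemma vcoset_eq (U : {vspace V}) (v w : V) : (v - w \in U) = (vcoset U v == vcoset U w).
Proof.
apply/idP/eqP => [vwU | /setP/(_ v)]; last by rewrite !inE subrr mem0v.
apply/setP => x; rewrite !inE -[x in RHS](subrK v) -addrA.
by rewrite (rpredDr _ vwU).
Qed.

Variable s : blocks.
Hypothesis s_dims : unzip1 s = d.
Hypothesis s_marks : forall i : 'I_(size d), (i \in marked alpha) = nth false (unzip2 s) i.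

(** The two clauses of [entry_okP] match the two components of a flag: the spans, and the cosets of
    the marked basis vectors. *)
Lemma stabilizer_flag_of g :
  (flag_of (g ** std_basis) == flag_of std_basis) = block_group s (GLval g).
Proof.
have szs : size s = size d by rewrite -s_dims size_map.
have nth_block Y i k : size Y = N -> (i < size d)%N -> (S i <= k < S i.+1)%N ->
    (take (nth 0%N d i) (drop (S i) Y))`_(k - S i) = Y`_k.
  move=> szY lt_i /andP[le_k lt_k]; rewrite nth_take ?nth_drop ?subnKC //.
  by rewrite ltn_subLR // -sumn_takeS.
have size_block Y i : size Y = N -> (i < size d)%N ->
    size (take (nth 0%N d i) (drop (S i) Y)) = nth 0%N d i.
  move=> szY lt_i; rewrite size_takel // size_drop szY leq_subRL ?le_S //.
  by rewrite -sumn_takeS // le_S.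
have sz_ge := size_mul_std g.
have sz_e := size_std_basis.
rewrite /block_group /= GL_unitmx /=; apply/eqP/pattern_mxP => [eq_flag j k | adm_g].
  have eq_span i : (i <= size d)%N ->
      <<take (S i) (g ** std_basis)>>%VS = <<take (S i) std_basis>>%VS.
    by move=> le_i; rewrite -!flag_space_of // eq_flag.
  apply/entry_okP; rewrite s_dims szs => i lt_i; split.
    by move/eq_span/eqP: lt_i => /span_take_std_mul H; apply: H; exact: le_S.
  rewrite -[i]/(Ordinal lt_i : nat) -s_marks => mk_i /= k_i le_j.
  have /ffunP/(_ (exist _ (Ordinal lt_i) mk_i)) := congr1 snd eq_flag.
  rewrite !ffunE /= eq_span ?(ltnW lt_i) // => /(congr1 (nth set0 ^~ (k - S i)%N)).
  have lt_k : (k - S i < nth 0%N d i)%N.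
    by case/andP: k_i => le_k lt_k; rewrite ltn_subLR // -sumn_takeS.
  rewrite !(nth_map 0) ?size_block // !nth_block // nth_mul_std_basis => /eqP.
  rewrite -vcoset_eq => /mem_span_std/(_ j le_j).
  rewrite mxE mul_std_basis_coef nth_std_basis !mxE eqxx andbT => /eqP.
  by rewrite subr_eq0 => /eqP.
have eq_span i : (i <= size d)%N ->
    <<take (S i) (g ** std_basis)>>%VS = <<take (S i) std_basis>>%VS.
  case: i => [|i] lt_i; first by rewrite !take0.
  apply/eqP/span_take_std_mul => [|j k k_i]; first exact: le_S.
  have /entry_okP := adm_g j k; rewrite s_dims szs => /(_ i lt_i)[H _]; exact: H.
congr pair; first by apply: eq_from_tnth => i; rewrite !tnth_mktuple eq_span.
apply/ffunP => -[i mk_i]; rewrite !ffunE /= eq_span ?(ltnW (ltn_ord i)) //.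
apply: (@eq_from_nth _ set0) => [|k]; first by rewrite !size_map !size_block.
rewrite size_map size_block // => lt_k.
have k_i : (S i <= S i + k < S i.+1)%N.
  by rewrite leq_addr sumn_takeS // ltn_add2l.
have lt_kN : (S i + k < N)%N.
  by case/andP: k_i => _ lt_k'; exact: leq_trans lt_k' (le_S _).
rewrite !(nth_map 0) ?size_block // -[k in LHS](addKn (S i)) -[k in RHS](addKn (S i)).
rewrite !nth_block //; apply/eqP; rewrite -vcoset_eq.
rewrite -[(S i + k)%N]/(Ordinal lt_kN : nat) nth_mul_std_basis.
apply/mem_span_std => j le_j.
rewrite mxE mul_std_basis_coef mxE nth_std_basis mxE eqxx andbT.
have /entry_okP := adm_g j (Ordinal lt_kN); rewrite s_dims szs => /(_ i (ltn_ord i))[_ ->] //.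
  by rewrite subrr.
by rewrite -s_marks.
Qed.

(** Every flag is a translate of the standard one by some [x], so the [g] carrying the translate by
    [x] to that by [w] are those with [w^-1 * g * x] in the block group. *)
Lemma transitive_on_flags (Y : {set {'GL_n[F]}}) :
  transitive_on (@act_flag F n alpha) Y (@is_flag F n alpha) <->
  exists r, forall y z : {'GL_n[F]},
    #|[set g in Y | block_group s (GLval (y * g * z)%g)]| = r.
Proof.
have e_flag x : is_flag (flag_of (x ** std_basis)).
  by apply: is_flag_of; rewrite ?size_mul_std // free_mulX free_std_basis.
have countE x w : #|[set g in Y | act_flag g (flag_of (x ** std_basis)) ==
      flag_of (w ** std_basis)]| =
    #|[set g in Y | block_group s (GLval (w^-1 * g * x)%g)]|.
  apply: eq_card => g; rewrite !inE -stabilizer_flag_of; congr (_ && _).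
  rewrite act_flag_of -mulGX; apply/eqP/eqP.
    move/(congr1 (act_flag w^-1%g)); rewrite !act_flag_of -!mulGX mulgA mulVg.
    by rewrite mul1X.
  move/(congr1 (act_flag w)); rewrite !act_flag_of -!mulGX -!mulgA mulKVg.
  by [].
split=> [[r Yr]|[r Yr]]; exists r.
  by move=> y z; rewrite -(Yr _ _ (e_flag z) (e_flag y^-1%g)) countE invgK.
move=> a b /flag_of_ex[X [szX freeX ->]] /flag_of_ex[X' [szX' freeX' ->]].
have [x ->] := free_mul_std szX freeX; have [w ->] := free_mul_std szX' freeX'.
by rewrite countE Yr.
Qed.

(** The two coefficients make the sum over the whole group zero, which turns constancy of a count
    into vanishing of sums. *)
Definition balanced_indicator (Y : {set {'GL_n[F]}}) (A : 'M[F]_N) : rat :=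
  #|{: {'GL_n[F]}}|%:R * (\sum_(g in Y) (GLval g == A)%:R) - #|Y|%:R.

Lemma sum_balanced_indicator (Y : {set {'GL_n[F]}}) (y z : {'GL_n[F]}) :
  \sum_(h | block_group s h) balanced_indicator Y (GLval y *m h *m GLval z) =
  #|{: {'GL_n[F]}}|%:R * #|[set g in Y | block_group s (GLval (y^-1 * g * z^-1)%g)]|%:R
  - #|Y|%:R * #|[pred h | @block_group F s N h]|%:R.
Proof.
rewrite sumrB -mulr_sumr sumr_const exchange_big /= -[X in _ - X = _]mulr_natr; congr (_ * _ - _).
rewrite -sum1_card natr_sum big_mkcond [RHS]big_mkcond; apply: eq_bigr => g _.
rewrite inE; case: (g \in Y); last by [].
rewrite andTb.
pose x := invmx (GLval y) *m GLval g *m invmx (GLval z).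
transitivity (if block_group s x then 1 else 0 : rat); last by [].
have gE (h : 'M[F]_N) : (GLval g == GLval y *m h *m GLval z) = (h == x).
  apply/eqP/eqP => [gE | ->].
    by rewrite /x gE -(mulmxA (GLval y)) mulKmx ?mulmxK ?GL_unitmx.
  rewrite /x -(mulmxA (invmx _)) !mulKVmx ?mulmxKV ?GL_unitmx //.
under eq_bigr do rewrite gE.
case: ifP => bg; last first.
  by rewrite big1 // => h bh; case: eqP bh => // ->; rewrite bg.
rewrite (bigD1 x) //= eqxx big1 ?addr0 // => h /andP[_ /negPf->].
by [].
Qed.

Lemma vanishes_balanced_indicator (Y : {set {'GL_n[F]}}) :
  vanishes s (balanced_indicator Y) <->
  exists r, forall y z : {'GL_n[F]},
    #|[set g in Y | block_group s (GLval (y * g * z)%g)]| = r.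
Proof.
set c := #|{: {'GL_n[F]}}|%:R : rat.
have c0 : c != 0 by rewrite pnatr_eq0 -lt0n; apply/card_gt0P; exists 1%g.
split=> [vY | [r Yr] y z uy uz].
  exists #|[set g in Y | block_group s (GLval (1 * g * 1)%g)]| => y z.
  have E (y1 z1 : {'GL_n[F]}) : c * #|[set g in Y | block_group s (GLval (y1 * g * z1)%g)]|%:R =
      #|Y|%:R * #|[pred h | @block_group F s N h]|%:R.
    apply/eqP; rewrite -subr_eq0.
    have := sum_balanced_indicator Y y1^-1%g z1^-1%g; rewrite !invgK => <-.
    by rewrite vY ?GL_unitmx.
  by apply/eqP; rewrite -(eqr_nat rat); apply/eqP/(mulfI c0); rewrite !E.
rewrite -[y]/(GLval (FinRing.Unit uy)) -[z]/(GLval (FinRing.Unit uz)).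
rewrite sum_balanced_indicator Yr; apply/eqP; rewrite subr_eq0 -!natrM eqr_nat.
pose H : {set {'GL_n[F]}} := [set x | block_group s (GLval x)].
have -> : #|[pred h | @block_group F s N h]| = #|H|.
  rewrite -(card_imset H (val_inj : injective (@GLval _ _))); apply: eq_card => h.
  apply/idP/imsetP => [bh | [x]]; last by rewrite !inE => ? ->.
  have uh : h \in unitmx by case/andP: bh.
  by exists (FinRing.Unit uh); rewrite ?inE.
(* Summing over [y] determines the constant: each [g] in [Y] is counted once for every element of
   [H]. *)
transitivity (\sum_(y : {'GL_n[F]}) #|[set g in Y | block_group s (GLval (y * g * 1)%g)]| == (#|Y| * #|H|)%N).
  by under eq_bigr do rewrite Yr; rewrite sum_nat_const.
under eq_bigr do rewrite -sum1_card big_mkcond.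
rewrite exchange_big /= -sum_nat_const [X in _ == X]big_mkcond; apply/eqP.
apply: eq_bigr => g _; rewrite -big_mkcond.
case Yg: (g \in Y); last by rewrite big1 // => x; rewrite inE Yg.
rewrite (reindex_inj (mulIg g^-1%g)) -[RHS]sum1_card; apply: eq_bigl => x.
have -> : (x \in H) = (x * g^-1 * g * 1 \in H)%g by rewrite mulgKV mulg1.
by rewrite !in_set Yg.
Qed.

End Bridge.

Local Open Scope nat_scope.

(** * Moves between block patterns *)

(** This carries a rearrangement of values back to labelled data: later, to pieces grouped by block
    and to pieces with marks. *)
Lemma perm_map_lift (T1 T2 : eqType) (f : T1 -> T2) s t :
  perm_eq (map f s) t -> exists2 s', perm_eq s s' & map f s' = t.
Proof.
elim: t s => [|y t IH] s p_st.
  by exists [::] => //; move/perm_size: p_st; case: s.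
have /mapP[x xs yE] : y \in map f s by rewrite (perm_mem p_st) mem_head.
have p_s := perm_to_rem xs; move: p_st.
rewrite (permPl (perm_map f p_s)) /= -yE perm_cons => /IH[s' p_s' <-].
by exists (x :: s'); rewrite /= ?yE // (permPl p_s) perm_cons.
Qed.

Lemma sumn_take_nth s k : sumn (take k s) = \sum_(i < k) nth 0 s i.
Proof.
elim: k s => [|k IH] [|x s] //; rewrite ?take0 ?big_ord0 //.
  by rewrite big1 // => i _; rewrite nth_nil.
by rewrite big_ord_recl /= IH.
Qed.

Lemma sumn_take_rev s k : sumn (take k (rev s)) = sumn s - sumn (take (size s - k) s).
Proof.
rewrite -[in sumn s](cat_take_drop (size s - k) s) sumn_cat addKn.
by rewrite take_rev sumn_rev.
Qed.

Lemma take_nseq_minn (T : Type) i j (x : T) : take i (nseq j x) = nseq (minn i j) x.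
Proof.
case: leqP => [le_ij|lt_ji]; first by rewrite take_nseq.
by rewrite take_oversize // size_nseq ltnW.
Qed.

Section Reachability.
Variable F : finFieldType.
Local Notation "s ~> t" := (leads F s t) (at level 70).
Local Notation un := (fun c : nat => (c, false)).
Local Notation mk := (fun c : nat => (c, true)).

Lemma leads_move a U : (a, true) :: map un U ~> map un U ++ [:: (a, true)].
Proof.
elim: U => [|c U IH] /=; first exact: leads_refl.
apply: leads_trans (leads_cons _ IH).
exact: (leads_cat (leads_swap F a c) (leads_refl F (map un U))).
Qed.

Definition unmarked (s : blocks) := unzip1 [seq x <- s | ~~ x.2].
Definition markeds (s : blocks) := unzip1 [seq x <- s | x.2].

Lemma leads_gather s : s ~> map un (unmarked s) ++ map mk (markeds s).
Proof.
elim: s => [|[c []] s IH]; first exact: leads_refl.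
  apply: leads_trans (leads_cons _ IH) _; rewrite -cat_cons.
  apply: leads_trans (leads_cat (leads_move _ _) (leads_refl _ _)) _.
  by rewrite -catA; exact: leads_refl.
exact: leads_trans (leads_cons _ IH) (leads_refl _ _).
Qed.

(** The marks in [L] are free, so cutting a marked block and forgetting the bases of some pieces is
    a single move, by [leads_marked] on each chunk of [L]. *)
Lemma leads_refine (bs : seq (seq nat)) (L : blocks) :
  unzip1 L = flatten bs -> map mk (map sumn bs) ~> L.
Proof.
elim: bs L => [|b bs IH] L /=; first by case: L => // _; exact: leads_refl.
move=> L_b; rewrite -(cat_take_drop (size b) L) -cat1s.
have szb : size b <= size L.
  by rewrite -(size_map fst) -/(unzip1 L) L_b size_cat leq_addr.
apply: leads_cat; last by apply: IH; rewrite /unzip1 map_drop -/(unzip1 L) L_b drop_size_cat.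
apply: leads_marked; rewrite /bsize /unzip1 map_take -/(unzip1 L) L_b.
by rewrite take_size_cat.
Qed.

Lemma leads_insert x V : sorted leq V ->
  map un (x :: V) ~> map un (sort leq (x :: V)).
Proof.
elim: V => [|y V IH] sV; first exact: leads_refl.
have [le_xy | lt_yx] := leqP x y.
  rewrite (sorted_sort leq_trans); first exact: leads_refl.
  by rewrite /= le_xy.
have -> : sort leq [:: x, y & V] = y :: sort leq (x :: V).
  apply: (sorted_eq leq_trans anti_leq); first exact/sort_sorted/leq_total.
    rewrite /= (path_sortedE leq_trans) sort_sorted; last exact: leq_total.
    rewrite andbT all_sort /= (ltnW lt_yx).
    by have := order_path_min leq_trans sV.
  by rewrite perm_sort (perm_catCA [:: x] [:: y] V) perm_cons perm_sym perm_sort.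
apply: leads_trans (leads_cons _ (IH (path_sorted sV))).
(* The split with [k = y] exchanges the two blocks. *)
have := leads_split F (ltnW lt_yx) (leqnn y); rewrite addnK => xy_yx.
exact: (leads_cat xy_yx (leads_refl F (map un V))).
Qed.

Lemma leads_sort U : map un U ~> map un (sort leq U).
Proof.
elim: U => [|x U IH]; first exact: leads_refl.
apply: leads_trans (leads_cons _ IH) _.
apply: leads_trans (leads_insert _ (sort_sorted leq_total U)) _.
rewrite (_ : sort leq (x :: sort leq U) = sort leq (x :: U)); first exact: leads_refl.
apply: (sorted_eq leq_trans anti_leq); try exact/sort_sorted/leq_total.
by rewrite perm_sort perm_sym perm_sort perm_cons perm_sym perm_sort.
Qed.

(* The unit is handed over from each entry to the next one, which only uses
   moves of adjacent blocks. *)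
Lemma leads_carry x A y B : path leq x (rcons A y) ->
  map un (x.+1 :: A ++ y :: B) ~> map un (x :: A ++ y.+1 :: B).
Proof.
have step a b C : a <= b -> map un (a.+1 :: b :: C) ~> map un (a :: b.+1 :: C).
  move=> le_ab; have := leads_split F (leqnSn a) le_ab.
  rewrite addSnnS addKn => ab; exact: (leads_cat ab (leads_refl F (map un C))).
elim: A x => [|z A IH] x /=; first by rewrite andbT; exact: step.
case/andP=> le_xz /IH A_y; apply: leads_trans (leads_cons _ A_y).
exact: step.
Qed.

(* If the heads differ, a unit goes from the head of u to the first position
   where the partial sums of u and w agree; u stays sorted there. *)
Lemma leads_dominated u w : sorted leq u -> sorted leq w -> size u = size w ->
  sumn u = sumn w -> (forall k, sumn (take k w) <= sumn (take k u)) ->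
  map un u ~> map un w.
Proof.
elim: w u => [|w1 w IHw] [|u1 u] //.
(* Inner induction on the excess of the head of [u]; at excess 0, dominance at the first position
   forces equal heads. *)
move Ed: (u1 - w1) => d; elim: d u1 Ed u => [|d IHd] u1 Ed u su sw /= [szu] sum_uw dom.
  have u1w1 : u1 = w1.
    by have := dom 1; rewrite /= !take0 /= !addn0; lia.
  rewrite u1w1 in sum_uw dom *; apply: leads_cons; apply: IHw => //.
  - exact: path_sorted su.
  - exact: path_sorted sw.
  - exact: addnI sum_uw.
  - by move=> k; have := dom k.+1; rewrite /= leq_add2l.
(* The full length is such a position, and the least one is at least 2 because the heads differ. *)
have ex_k : exists k, (sumn (take k (w1 :: w)) == sumn (take k (u1 :: u))) && (0 < k).
  exists (size w).+1; rewrite -[(size w).+1]/(size (w1 :: w)) take_size.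
  by rewrite /= -szu take_size sum_uw eqxx.
case: (ex_minnP ex_k) => -[|[|k]] //=.
  by rewrite !take0 /= !addn0 andbT => /eqP w1u1; lia.
rewrite andbT => /eqP eq_k min_k.
have strict j : 0 < j < k.+2 -> sumn (take j (w1 :: w)) < sumn (take j (u1 :: u)).
  case/andP=> j0 lt_jk; rewrite ltn_neqAle dom andbT.
  apply: contraTneq lt_jk => /eqP eq_j; rewrite -leqNgt; apply: min_k.
  by rewrite eq_j.
have lt_ku : k < size u.
  rewrite ltnNge; apply/negP => le_uk; have := strict k.+1; rewrite leqnn /= => /(_ isT).
  have -> : take k u = u by rewrite take_oversize.
  have -> : take k w = w by rewrite take_oversize -?szu.
  by rewrite sum_uw ltnn.
set y := nth 0 u k; set A := take k u; set B := drop k.+1 u.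
have uE : u = A ++ y :: B by rewrite -drop_nth // cat_take_drop.
have szA : size A = k by rewrite size_takel // ltnW.
(* The partial sums differ strictly just before [y] and agree once it is included. *)
have lt_y : y < nth 0 w k.
  have := strict k.+1; rewrite leqnn /= => /(_ isT).
  move: eq_k; rewrite /= (take_nth 0 lt_ku) (take_nth 0 (_ : k < size w)) -?szu //.
  rewrite -!cats1 !sumn_cat /= -/y; lia.
(* Dominance one position later and the order of [w] give [y < nth 0 w k <= nth 0 w k.+1 <= z]. *)
have le_yB : path leq y.+1 B.
  have : path leq y B.
    by move: su; rewrite /= uE cat_path /= => /and3P[].
  case EB: B => [|z B'] //= /andP[_ ->]; rewrite andbT.
  have lt_k1 : k.+1 < size u.
    by rewrite ltnNge; apply/negP => le_uk; move: EB; rewrite /B drop_oversize.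
  have zE : z = nth 0 u k.+1 by rewrite -[k.+1]addn0 -nth_drop -/B EB.
  have lt_k1w : k.+1 < size w by rewrite -szu.
  have := dom k.+3; move: eq_k.
  rewrite /= (take_nth 0 lt_k1) (take_nth 0 lt_k1w) -!cats1 !sumn_cat /= -zE.
  have : nth 0 w k <= nth 0 w k.+1.
    by have /(sortedP 0) -> := path_sorted sw.
  lia.
have su' : path leq u1.-1 (A ++ y.+1 :: B).
  move: su; rewrite /= uE !cat_path /= le_yB !andbT => /and3P[pA le_y _].
  case: (A) pA le_y => [|a A'] /=; rewrite ?andbT; first by move=> _; lia.
  by move=> /andP[le_a ->] le_y; rewrite andbT leqW // andbT; lia.
have u1E : u1 = u1.-1.+1 by lia.
apply: (@leads_trans _ _ (map un (u1.-1 :: A ++ y.+1 :: B))).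
  rewrite [X in (X, false)]u1E uE; apply: (@leads_carry u1.-1 A y B).
  move: su; rewrite /= uE -cats1 !cat_path /= andbT => /and3P[pA le_y _].
  case: (A) pA le_y => [|a A'] /=; first by move=> _; lia.
  by move=> /andP[le_a ->] ->; rewrite !andbT; lia.
apply: IHd => //; first lia.
- by rewrite /= size_cat /= -szu uE size_cat.
- by move: sum_uw; rewrite uE /= !sumn_cat /=; lia.
(* The partial sums of [u] drop by one only where they were strictly larger, so dominance
   survives. *)
move=> [|j] //=; have := dom j.+1; rewrite /= uE.
rewrite !take_cat szA; case: ltnP => [lt_jk _|le_kj].
  have := strict j.+1; rewrite /= uE take_cat szA lt_jk => /(_ _); lia.
case Ejk: (j - k) => [|i] /=.
  have -> : j = k by lia.
  by have := strict k.+1; rewrite leqnn /= -/A => /(_ isT); rewrite cats0; lia.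
rewrite !sumn_cat /=; lia.
Qed.

Lemma perm_unmarked s t : perm_eq s t -> perm_eq (unmarked s) (unmarked t).
Proof. by move=> st; apply/perm_map/perm_filter. Qed.

Lemma perm_markeds s t : perm_eq s t -> perm_eq (markeds s) (markeds t).
Proof. by move=> st; apply/perm_map/perm_filter. Qed.

Lemma leads_pad z U : map un U ~> map un (nseq z 0 ++ U).
Proof.
rewrite map_cat -[X in X ~> _]cat0s; apply: leads_cat; last exact: leads_refl.
by apply: leads_size0 => //; rewrite /bsize /unzip1 -map_comp map_nseq sumn_nseq.
Qed.

Lemma leads_unpad z U : map un (nseq z 0 ++ U) ~> map un U.
Proof.
rewrite map_cat -[X in _ ~> X]cat0s; apply: leads_cat; last exact: leads_refl.
by apply: leads_size0 => //; rewrite /bsize /unzip1 -map_comp map_nseq sumn_nseq.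
Qed.

Lemma sumn_pos_ge_size v : 0 \notin v -> size v <= sumn v.
Proof. by elim: v => [|[|x] v IH] //; rewrite inE => /IH le_v; rewrite /= addSn ltnS (leq_trans le_v) ?leq_addl. Qed.

(* The parts of tau' are positive, so beyond the last part of tau each of its
   partial sums grows by at least one until the total is exhausted. *)
Lemma dominated_ones tau tau' m : 0 \notin tau' -> sumn tau + m = sumn tau' ->
  dominated tau tau' -> dominated (tau ++ nseq m 1) tau'.
Proof.
move=> pos sum_tau dom k k0; rewrite -!sumn_take_nth take_cat.
case: ltnP => [_|le_k]; first by rewrite !sumn_take_nth dom.
rewrite sumn_cat take_nseq_minn sumn_nseq mul1n.
have [le_tk|lt_kt] := leqP (size tau') k.
  by rewrite (take_oversize le_tk); lia.
have /(_ (size tau)) dom_tau : forall j, sumn (take j tau) <= sumn (take j tau').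
  by case=> [|j]; rewrite ?take0 // !sumn_take_nth dom.
rewrite take_size in dom_tau.
have -> : sumn (take k tau') = sumn (take (size tau) tau') + sumn (drop (size tau) (take k tau')).
  by rewrite -sumn_cat -[in X in X ++ _](minn_idPl le_k) take_min cat_take_drop.
have := @sumn_pos_ge_size (drop (size tau) (take k tau')).
rewrite size_drop size_takel ?(ltnW lt_kt) // => le_drop.
have {le_drop} := le_drop (contra (fun z => mem_take (mem_drop z)) pos); lia.
Qed.

(** Increasing order reverses dominance: partial sums of a reversed list are the total minus partial
    sums of the list, so [rev tau] has the larger ones, as [leads_dominated] requires. *)
Lemma leads_partition tau tau' U : is_partition tau -> is_partition tau' ->
  sumn tau = sumn tau' -> dominated tau tau' -> perm_eq U tau ->
  map un U ~> map un (rev tau').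
Proof.
move=> /andP[s_tau _] /andP[s_tau' _] sum_tau dom U_tau.
apply: leads_trans (leads_sort U) _.
have -> : sort leq U = rev tau.
  apply: (sorted_eq leq_trans anti_leq); first exact/sort_sorted/leq_total.
    by rewrite rev_sorted.
  by rewrite perm_sort (permPl U_tau) perm_sym perm_rev.
(* Leading zeros give both lists the length [size tau + size tau']. *)
apply: leads_trans (leads_pad (size tau') _) _.
apply: leads_trans (leads_unpad (size tau) _).
have pad z v : nseq z 0 ++ rev v = rev (v ++ nseq z 0) by rewrite rev_cat rev_nseq.
have sum_pad z v j : sumn (take j (v ++ nseq z 0)) = sumn (take j v).
  rewrite take_cat; case: ltnP => // le_vj.
  by rewrite sumn_cat take_nseq_minn sumn_nseq mul0n addn0 take_oversize.
have sort_pad z v : sorted geq v -> sorted geq (v ++ nseq z 0).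
  case: v => [_|x v] /=; first by case: z => //= z; elim: z => //=.
  by move=> xv; rewrite cat_path xv /=; elim: z (last x v) => //= z IH y; rewrite leq0n IH.
apply: leads_dominated; rewrite ?pad ?rev_sorted ?sort_pad //.
- by rewrite !size_rev !size_cat !size_nseq addnC.
- by rewrite !sumn_rev !sumn_cat !sumn_nseq !mul0n sum_tau.
move=> k; rewrite !sumn_take_rev !sum_pad !sumn_cat !sumn_nseq !mul0n sum_tau.
rewrite !size_cat !size_nseq (addnC (size tau')) leq_sub2l //.
by case: (_ - k) => [|j]; rewrite ?take0 // !sumn_take_nth dom.
Qed.

Lemma unmarked_cat S U : unmarked (map mk S ++ map un U) = U.
Proof. by elim: S => [|c S] //=; elim: U => [|c U IH] //=; rewrite -[in RHS]IH. Qed.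

Lemma markeds_cat S U : markeds (map mk S ++ map un U) = S.
Proof.
elim: S => [|c S IH] /=; first by elim: U.
by rewrite -[in RHS]IH.
Qed.

Lemma is_partition_ones tau m : is_partition tau -> is_partition (tau ++ nseq m 1).
Proof.
case/andP=> s_tau pos; rewrite /is_partition mem_cat negb_or pos mem_nseq andbF andbT.
case: tau s_tau pos => [_ _|x tau] /=; first by case: m => //= m; elim: m.
rewrite inE => x_tau /norP[x0 pos]; rewrite cat_path x_tau /=.
have : 0 < last x tau.
  rewrite lt0n; apply/negP => /eqP last0; have := mem_last x tau.
  by rewrite last0 inE (negPf x0) (negPf pos).
by elim: m (last x tau) => //= m IH y ->; apply: IH.
Qed.

Lemma leads_pair_le s sigma tau sigma' tau' :
  is_partition tau -> is_partition tau' ->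
  perm_eq (markeds s) sigma -> perm_eq (unmarked s) tau ->
  sumn sigma + sumn tau = sumn sigma' + sumn tau' ->
  pair_le (sigma, tau) (sigma', tau') ->
  exists2 S, perm_eq S sigma' & s ~> map un (rev tau') ++ map mk S.
Proof.
move=> p_tau p_tau' s_sigma s_tau sum_eq [[/= le_sigma [bs0 bs0_sigma p_bs0]] /= dom].
set m := sumn sigma - sumn sigma' in p_bs0.
(* The cuts are put in the order in which the marked blocks occur in [s]. *)
have [bs p_bs bsE] : exists2 bs, perm_eq bs0 bs & map sumn bs = markeds s.
  by apply: perm_map_lift; rewrite bs0_sigma perm_sym.
(* Pieces that make up [sigma'] keep their bases; the [m] surplus ones become unmarked and join
   [tau]. *)
have [L p_L L_bs] : exists2 L, perm_eq (map mk sigma' ++ map un (nseq m 1)) L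
    & unzip1 L = flatten bs.
  apply: perm_map_lift; rewrite map_cat -!map_comp !map_id_in //.
  by rewrite -(permPl p_bs0) perm_flatten // perm_sym.
have p_unL : perm_eq (nseq m 1) (unmarked L).
  by rewrite -(permPr (perm_unmarked p_L)) unmarked_cat.
have mkL : perm_eq (markeds L) sigma'.
  by rewrite perm_sym -(permPr (perm_markeds p_L)) markeds_cat.
exists (markeds L) => //.
apply: leads_trans (leads_gather s) _; rewrite -bsE.
apply: leads_trans (leads_cat (leads_refl _ _) (leads_refine L_bs)) _.
apply: leads_trans (leads_cat (leads_refl _ _) (leads_gather L)) _.
rewrite catA -map_cat; apply: leads_cat; last exact: leads_refl.
apply: (@leads_partition (tau ++ nseq m 1)) => //.
- by rewrite is_partition_ones.
- by rewrite sumn_cat sumn_nseq mul1n /m; lia.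
- apply: dominated_ones => //; first by case/andP: p_tau'.
  by rewrite /m; lia.
by apply: perm_cat => //; rewrite perm_sym.
Qed.

End Reachability.

(** * Flag shapes as lists of marked blocks, and assembly of the moves *)

Definition shape_blocks (alpha : flag_shape) : blocks :=
  [seq (nth 0 (dims alpha) i, i \in marked alpha) | i : 'I_(size (dims alpha)) <- enum 'I_(size (dims alpha))].

Lemma unzip1_shape_blocks alpha : unzip1 (shape_blocks alpha) = dims alpha.
Proof.
rewrite /unzip1 -map_comp -[RHS](mkseq_nth 0) /mkseq -val_enum_ord -map_comp.
exact: eq_map.
Qed.

Lemma nth_shape_blocks alpha (i : 'I_(size (dims alpha))) :
  (i \in marked alpha) = nth false (unzip2 (shape_blocks alpha)) i.
Proof.
by rewrite /unzip2 -map_comp (nth_map i) ?size_enum_ord // nth_ord_enum.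
Qed.

Lemma shape_type_blocks alpha : shape_type alpha =
  (sort geq (markeds (shape_blocks alpha)), sort geq (unmarked (shape_blocks alpha))).
Proof.
have filter_enum (A : {set 'I_(size (dims alpha))}) :
    enum A = [seq i <- enum 'I_(size (dims alpha)) | i \in A] by rewrite enumT.
rewrite /shape_type /image_mem !filter_enum /markeds /unmarked /shape_blocks.
congr (sort _ _, sort _ _); elim: (enum 'I__) => //= i r IH.
  by case: ifP => _ /=; rewrite IH.
by rewrite inE; case: ifP => _ /=; rewrite IH.
Qed.

Definition blocks_shape (s : blocks) : flag_shape :=
  @FlagShape (unzip1 s) [set i : 'I_(size (unzip1 s)) | nth false (unzip2 s) i].

Lemma blocks_shapeK : cancel blocks_shape shape_blocks.
Proof.
move=> s; apply: (@eq_from_nth _ (0, false)) => [|i].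
  by rewrite size_map size_enum_ord size_map.
rewrite size_map size_enum_ord => lt_i.
rewrite (nth_map (Ordinal lt_i)) ?size_enum_ord //.
rewrite (nth_ord_enum (Ordinal lt_i) (Ordinal lt_i)) inE /=.
have lt_is : i < size s by rewrite /= size_map in lt_i.
by rewrite !(nth_map (0, false)) // -surjective_pairing.
Qed.

Lemma sumn_shape_type alpha :
  sumn (shape_type alpha).1 + sumn (shape_type alpha).2 = sumn (dims alpha).
Proof.
rewrite shape_type_blocks -[in RHS]unzip1_shape_blocks /= !(perm_sumn (permEl (perm_sort _ _))).
elim: (shape_blocks alpha) => [|[c []] s IH] //=; rewrite -IH; first exact/esym/addnA.
exact: addnCA.
Qed.

Theorem corollary3p7 (F : finFieldType) (n : nat) (hn : 1 <= n)
    (Y : {set {'GL_n[F]}}) (sigma tau : seq nat)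
    (hTheta : in_Theta n #|F| (sigma, tau))
    (hY : type_transitive Y (sigma, tau)) :
  forall sigma' tau' : seq nat,
    in_Theta n #|F| (sigma', tau') ->
    pair_le (sigma, tau) (sigma', tau') ->
    type_transitive Y (sigma', tau').
Proof.
move=> sigma' tau' hTheta' le_types.
have nE : n = n.-1.+1 by rewrite prednK.
have /andP[/= p_sigma p_tau] := in_Theta_partition hTheta.
have /andP[/= p_sigma' p_tau'] := in_Theta_partition hTheta'.
have sum_Theta st : in_Theta n #|F| st -> sumn st.1 + sumn st.2 = n.
  by case=> beta [/andP[_ /eqP sum_beta] _] <-; rewrite sumn_shape_type.
case: hY => alpha [[/andP[_ /eqP sum_alpha] _] type_alpha trY].
have sum_alphaN : sumn (dims alpha) = n.-1.+1 by rewrite sum_alpha -nE.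
have := type_alpha; rewrite shape_type_blocks => -[sigmaE tauE].
have [S p_S leads_S] : exists2 S, perm_eq S sigma' &
    leads F (shape_blocks alpha)
      (map (fun c => (c, false)) (rev tau') ++ map (fun c => (c, true)) S).
  apply: (leads_pair_le _ p_tau p_tau' _ _ _ le_types).
  - by rewrite -sigmaE perm_sym perm_sort.
  - by rewrite -tauE perm_sym perm_sort.
  by rewrite (sum_Theta _ hTheta) (sum_Theta _ hTheta').
set s := _ ++ _ in leads_S; have [sz_s leads_s] := leads_S.
have unmarked_s : unmarked s = rev tau'.
  rewrite /s; elim: (rev tau') => [|c r IH] /=; first by elim: (S).
  by rewrite -[in RHS]IH.
have markeds_s : markeds s = S.
  rewrite /s; elim: (rev tau') => [|c r IH] //=.
  by elim: (S) => [|c r IH] //=; rewrite -[in RHS]IH.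
have type_s : shape_type (blocks_shape s) = (sigma', tau').
  rewrite shape_type_blocks blocks_shapeK unmarked_s markeds_s.
  have geq_trans : transitive geq by move=> a b c ab bc; exact: leq_trans bc ab.
  have geq_anti : antisymmetric geq by move=> a b; rewrite andbC => /anti_leq.
  have geq_total : total geq by move=> a b; exact: leq_total.
  have sortE r r' : sorted geq r' -> perm_eq r r' -> sort geq r = r'.
    move=> s_r' p_r; apply: (sorted_eq geq_trans geq_anti) => //.
      exact: sort_sorted.
    by rewrite perm_sort.
  case/andP: p_sigma' => s_sigma' _; case/andP: p_tau' => s_tau' _.
  by congr pair; apply: sortE; rewrite ?perm_rev.
have bsizeE r : bsize r = sumn (unzip1 r) by [].
have sum_s : sumn (unzip1 s) = n.-1.+1.
  by rewrite -bsizeE -sz_s bsizeE unzip1_shape_blocks.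
exists (blocks_shape s); split=> //.
  split.
    rewrite /is_composition /= -nE in sum_s *; rewrite sum_s eqxx andbT.
    case/andP: p_sigma' => _ pos_sigma'; case/andP: p_tau' => _ pos_tau'.
    rewrite /s /unzip1 map_cat -!map_comp !map_id_in // mem_cat negb_or.
    by rewrite mem_rev pos_tau' (perm_mem p_S).
  (* The condition for [q = 2] depends only on [tau'], so it is inherited from the shape witnessing
     that the target pair is a type. *)
  move=> q2 i i_unmarked; case: hTheta' => beta [_ /(_ q2) gt1] [_ tauE'].
  have : nth 0 (dims (blocks_shape s)) i \in tau'.
    rewrite -[tau']/((sigma', tau').2) -type_s mem_sort.
    by apply: image_f; rewrite inE.
  rewrite -tauE' mem_sort => /imageP[j]; rewrite inE => j_unmarked ->.
  exact: gt1.
have sum_s' : sumn (dims (blocks_shape s)) = n.-1.+1 by [].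
(* Transitivity becomes vanishing sums of the balanced indicator, which [leads_s] transfers to the
   new shape. *)
apply: (proj2 (transitive_on_flags sum_s' (unzip1_shape_blocks _) (@nth_shape_blocks _) Y)).
apply/vanishes_balanced_indicator; rewrite blocks_shapeK; apply: leads_s.
  by rewrite bsizeE unzip1_shape_blocks.
apply/vanishes_balanced_indicator.
exact: (proj1 (transitive_on_flags sum_alphaN (unzip1_shape_blocks _) (@nth_shape_blocks _) Y)).
Qed.
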